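(* Let $G$ be a Lie group acting properly on a manifold $M$, let $X\in\Gamma(TM)^G$, let $x_1,x_2\in M$ be two points on the same $G$-orbit, with stabilizers $H_1,H_2$, which are relative equilibria of $X$ (i.e. $X(x_i)$ is tangent to $G\cdot x_i$), let $S_1,S_2$ be slices through $x_1,x_2$ respectively, and let $X^{S_i}\in\Gamma(TS_i)^{H_i}$ be the component of $X$ tangent to $S_i$ (defined by a choice of $H_i$-equivariant splitting $\mathfrak g=\mathfrak h_i\oplus\mathfrak m_i$). Let $\varphi:S_1\to S_2$ (with the slices shrunk if necessary) be an equivariant diffeomorphism with $\varphi(x_1)=x_2$ such that $\varphi_*(X^{S_1})$ and $X^{S_2}$ are isomorphic. Then $$D(X^{S_2})(x_2)-T\varphi_{x_1}\circ D(X^{S_1})(x_1)\circ (T\varphi_{x_1})^{-1}\in\delta\rho(\mathfrak h_2^{H_2}),$$ where $\rho:H_2\to GL(T_{x_2}S_2)$ is the slice representation, $\delta\rho$ is the corresponding representation of $\mathfrak h_2$, and $\mathfrak h_2^{H_2}$ is the space of vectors in the Lie algebra $\mathfrak h_2$ of $H_2$ fixed by the adjoint representation of $H_2$. In particular the linear map $T\varphi_{x_1}:T_{x_1}S_1\to T_{x_2}S_2$ sends the eigenvectors of the linearization $D(X^{S_1})(x_1)$ to the eigenvectors of $D(X^{S_2})(x_2)$, and the real parts of the corresponding eigenvalues are the same.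
   Context: Everything is smooth. $\mathfrak g$ is the Lie algebra of $G$. For $\xi\in\mathfrak g$, $\xi_M(m)=\frac{d}{dt}\big|_{t=0}\exp(t\xi)\cdot m$. Eigenvectors and eigenvalues are taken in the complexifications. Slice: a slice through $x\in M$, with stabilizer $H=G_x$, is an embedded $H$-invariant submanifold $S\subset M$ containing $x$ such that $G\cdot S$ is open in $M$ and $[g,s]\mapsto g\cdot s$ is a $G$-equivariant diffeomorphism from $G\times^H S=(G\times S)/H$ onto $G\cdot S$. The slice representation is the linear action of $H$ on $T_xS$ by differentials at $x$. Component $X^S$: given an $H$-equivariant (i.e. $\mathrm{Ad}(H)$-invariant) splitting $\mathfrak g=\mathfrak h\oplus\mathfrak m$, for each $y\in S$ one has $T_yM=T_yS\oplus\{\xi_M(y):\xi\in\mathfrak m\}$; $X^S(y)$ is the $T_yS$-component of $X(y)$. It is an $H$-invariant vector field on $S$, and it vanishes at $x$ when $x$ is a relative equilibrium of $X$. $D(X^S)(x):T_xS\to T_xS$ denotes the linearization of $X^S$ at the zero $x$. Equivariant diffeomorphism $\varphi:S_1\to S_2$ means: for some $g\in G$ with $g\cdot x_1=x_2$ (so $H_2=gH_1g^{-1}$), $\varphi(h\cdot y)=(ghg^{-1})\cdot\varphi(y)$ for all $h\in H_1$, $y\in S_1$. Isomorphic: two $H$-invariant vector fields $Z,Z'$ on a manifold $S$ with an action of a Lie group $H$ with Lie algebra $\mathfrak h$ are isomorphic if $Z=Z'+\psi_S$ for some smooth map $\psi:S\to\mathfrak h$ with $\psi(h\cdot y)=\mathrm{Ad}(h)\psi(y)$,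 where $\psi_S(y)=\frac{d}{dt}\big|_{t=0}\exp(t\psi(y))\cdot y$.
   Formalization: ''Sends the eigenvectors to the eigenvectors'' fails for some vectors of a multiple eigenspace (e.g. D1=0, D2=-J); it is stated as: each eigenspace of D1 has a basis sent by Tφ to eigenvectors of D2 with equal real parts of eigenvalues, and conversely for the inverse of Tφ. *)

(* Defs.v *)
From HB Require Import structures.
From mathcomp Require Import all_boot all_order all_algebra.
From mathcomp Require Import complex.
From mathcomp Require Import all_classical all_reals all_analysis.

Set Implicit Arguments.
Unset Strict Implicit.
Unset Printing Implicit Defensive.

Import Order.TTheory GRing.Theory Num.Theory.
Import numFieldNormedType.Exports.

Local Open Scope classical_set_scope.
Local Open Scope ring_scope.

(* f is C^k on the open set U, for V of finite dimension: the directional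
   derivatives 'd f x v are C^(k-1) in x for each fixed v. *)
Fixpoint Cr (R : realType) (k : nat) (V W : normedModType R)
    (U : set V) (f : V -> W) : Prop :=
  if k is k'.+1 then
    (forall x, U x -> differentiable f x) /\
    (forall v : V, Cr k' U (fun x => 'd f x v))
  else forall x, U x -> {for x, continuous f}.

Definition smooth_on (R : realType) (V W : normedModType R)
    (U : set V) (f : V -> W) : Prop := forall k, Cr k U f.

(* The functions cmap and cinv are total, but only their values on chart_dom
   and on its image are meaningful. *)
Record chart (R : realType) (T : topologicalType) (n : nat) := Chart {
  chart_dom : set T;
  cmap :> T -> 'rV[R]_n;
  cinv : 'rV[R]_n -> T;
  chart_dom_open : open chart_dom;
  cmap_open : open (cmap @` chart_dom);
  cmap_cont : forall x, chart_dom x -> {for x, continuous cmap};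
  cinv_cont : forall p, (cmap @` chart_dom) p -> {for p, continuous cinv};
  cmapK : forall x, chart_dom x -> cinv (cmap x) = x
}.

(* The atlas need not be maximal.  The field chart_at selects one chart around
   each point x; the tangent space at x is modelled on 'rV_(mdim M) through the
   chart chart_at x. *)
Record manifold (R : realType) := Manifold {
  mcarrier :> topologicalType;
  mdim : nat;
  atlas : set (chart R mcarrier mdim);
  chart_at : mcarrier -> chart R mcarrier mdim;
  chart_at_atlas : forall x, atlas (chart_at x);
  chart_at_dom : forall x, chart_dom (chart_at x) x;
  atlas_compat : forall c d, atlas c -> atlas d ->
    smooth_on (c @` (chart_dom c `&` chart_dom d)) (d \o cinv c);
  manifold_hausdorff : hausdorff_space mcarrier;
  manifold_second_countable : @second_countable mcarrier
}.
Arguments atlas {R} m.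
Arguments mdim {R} m.
Arguments chart_at {R m} x.

(* T_x M, in the coordinates of chart_at x.  Linear maps between tangent spaces
   are matrices acting on the right of row vectors, so that the composite
   "g after f" is the product F *m G. *)
Definition tangent (R : realType) (M : manifold R) (x : M) := 'rV[R]_(mdim M).

(* Smoothness of a map on an open set U; the values of f outside U are
   irrelevant. *)
Definition smooth_in (R : realType) (M N : manifold R) (U : set M)
    (f : M -> N) : Prop :=
  (forall x, U x -> {for x, continuous f}) /\
  forall c d, atlas M c -> atlas N d ->
    smooth_on (c @` (U `&` chart_dom c `&` (f @^-1` chart_dom d)))
              (d \o f \o cinv c).

Definition smooth_map (R : realType) (M N : manifold R) (f : M -> N) : Prop :=
  smooth_in setT f.

(* Smoothness of f : M x N -> P for the product manifold structure, whose atlas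
   consists of the products of charts. *)
Definition smooth_map2 (R : realType) (M N P : manifold R)
    (f : M -> N -> P) : Prop :=
  continuous (fun q : M * N => f q.1 q.2) /\
  forall c d e, atlas M c -> atlas N d -> atlas P e ->
    smooth_on ((fun q : M * N => (c q.1, d q.2)) @`
                 [set q : M * N | [/\ chart_dom c q.1, chart_dom d q.2 &
                                      chart_dom e (f q.1 q.2)]])
              (fun q : 'rV[R]_(mdim M) * 'rV[R]_(mdim N) =>
                 e (f (cinv c q.1) (cinv d q.2))).

Definition smooth_vec (R : realType) (M : manifold R) (W : normedModType R)
    (U : set M) (f : M -> W) : Prop :=
  forall c, atlas M c -> smooth_on (c @` (U `&` chart_dom c)) (f \o cinv c).

Definition smooth_curve (R : realType) (M : manifold R) (gam : R -> M) : Prop :=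
  continuous gam /\
  forall c, atlas M c ->
    smooth_on (gam @^-1` chart_dom c : set R^o) (fun t : R^o => c (gam t)).

(* f : U -> V is a diffeomorphism between open sets, with inverse f'. *)
Definition diffeo_on (R : realType) (M N : manifold R) (U : set M) (V : set N)
    (f : M -> N) (f' : N -> M) : Prop :=
  [/\ open U, open V, smooth_in U f & smooth_in V f'] /\
  [/\ forall x, U x -> V (f x), forall y, V y -> U (f' y),
      forall x, U x -> f' (f x) = x & forall y, V y -> f (f' y) = y].

(* T_x f : T_x M -> T_(f x) N *)
Definition differential (R : realType) (M N : manifold R) (f : M -> N) (x : M) :
    'M[R]_(mdim M, mdim N) :=
  jacobian (chart_at (f x) \o f \o cinv (chart_at x)) (chart_at x x).

(* T_(x, y) f : T_x M x T_y N -> T_(f x y) P *)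
Definition differential2 (R : realType) (M N P : manifold R) (f : M -> N -> P)
    (x : M) (y : N) : 'rV[R]_(mdim M) * 'rV[R]_(mdim N) -> 'rV[R]_(mdim P) :=
  'd (fun q : 'rV[R]_(mdim M) * 'rV[R]_(mdim N) =>
        chart_at (f x y) (f (cinv (chart_at x) q.1) (cinv (chart_at y) q.2)))
     (chart_at x x, chart_at y y).

(* The derivative of a curve at 0, a vector of T_(gam 0) M. *)
Definition velocity (R : realType) (M : manifold R) (gam : R -> M) :
    tangent (gam 0) :=
  derive1 (fun t : R => chart_at (gam 0) (gam t)) 0.

Definition vfield (R : realType) (M : manifold R) := forall x : M, tangent x.

(* The coordinates in the chart c of a tangent vector v at x. *)
Definition tcoord (R : realType) (M : manifold R) (c : chart R M (mdim M)) (x : M)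
    (v : tangent x) : 'rV[R]_(mdim M) :=
  v *m jacobian (c \o cinv (chart_at x)) (chart_at x x).

Definition vfield_in_chart (R : realType) (M : manifold R) (X : vfield M)
    (c : chart R M (mdim M)) (p : 'rV[R]_(mdim M)) : 'rV[R]_(mdim M) :=
  tcoord c (X (cinv c p)).

Definition smooth_vfield (R : realType) (M : manifold R) (X : vfield M) : Prop :=
  forall c, atlas M c -> smooth_on (c @` chart_dom c) (vfield_in_chart X c).

(* D(X)(x) : T_x M -> T_x M, for a zero x of X. *)
Definition linearization (R : realType) (M : manifold R) (X : vfield M) (x : M) :
    'M[R]_(mdim M) :=
  jacobian (vfield_in_chart X (chart_at x)) (chart_at x x).

Definition push_vfield (R : realType) (M N : manifold R)
    (f : M -> N) (f' : N -> M) (X : vfield M) : vfield N :=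
  fun z => X (f' z) *m differential f (f' z).

Record lie_group (R : realType) := LieGroup {
  lg_manifold :> manifold R;
  lg_one : lg_manifold;
  lg_mul : lg_manifold -> lg_manifold -> lg_manifold;
  lg_inv : lg_manifold -> lg_manifold;
  lg_mulA : forall a b c, lg_mul a (lg_mul b c) = lg_mul (lg_mul a b) c;
  lg_mul1 : forall a, lg_mul lg_one a = a;
  lg_mulV : forall a, lg_mul (lg_inv a) a = lg_one;
  lg_mul_smooth : smooth_map2 lg_mul;
  lg_inv_smooth : smooth_map lg_inv
}.
Arguments lg_one {R} l.
Arguments lg_mul {R l}.
Arguments lg_inv {R l}.

Notation Lie G := (tangent (lg_one G)).

Definition conjG (R : realType) (G : lie_group R) (g a : G) : G :=
  lg_mul (lg_mul g a) (lg_inv g).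

Definition Ad (R : realType) (G : lie_group R) (g : G) (xi : Lie G) : Lie G :=
  xi *m differential (conjG g) (lg_one G).

(* The exponential map of G: t |-> exp (t xi) is the one-parameter subgroup with
   velocity xi.  This property determines exp uniquely. *)
Record exponential (R : realType) (G : lie_group R) := Exponential {
  exp_fun :> Lie G -> G;
  exp_add : forall (xi : Lie G) (s t : R),
    exp_fun ((s + t) *: xi) = lg_mul (exp_fun (s *: xi)) (exp_fun (t *: xi));
  exp_smooth : forall xi : Lie G, smooth_curve (fun t : R => exp_fun (t *: xi));
  exp_velocity : forall xi : Lie G, velocity (fun t : R => exp_fun (t *: xi)) = xi
}.

(* The Lie algebra of a closed subgroup H of G. *)
Definition sub_lie (R : realType) (G : lie_group R) (expG : exponential G)
    (H : set G) : set (Lie G) :=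
  [set xi | forall t : R, H (expG (t *: xi))].

Definition sub_lie_fixed (R : realType) (G : lie_group R) (expG : exponential G)
    (H : set G) : set (Lie G) :=
  [set xi | sub_lie expG H xi /\ forall h, H h -> Ad h xi = xi].

(* An H-equivariant splitting: m is an Ad(H)-invariant complement of the Lie
   algebra of H. *)
Definition equivariant_splitting (R : realType) (G : lie_group R)
    (expG : exponential G) (H : set G) (m : {vspace Lie G}) : Prop :=
  [/\ forall xi : Lie G, exists eta zeta : Lie G,
        [/\ sub_lie expG H eta, zeta \in m & xi = eta + zeta],
      forall xi : Lie G, sub_lie expG H xi -> xi \in m -> xi = 0 &
      forall (h : G) (xi : Lie G), H h -> xi \in m -> Ad h xi \in m].

Record smooth_action (R : realType) (G : lie_group R) (M : manifold R) := Action {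
  act_fun :> G -> M -> M;
  act1 : forall x, act_fun (lg_one G) x = x;
  actM : forall g h x, act_fun (lg_mul g h) x = act_fun g (act_fun h x);
  act_smooth : smooth_map2 act_fun
}.

Definition proper_action (R : realType) (G : lie_group R) (M : manifold R)
    (A : smooth_action G M) : Prop :=
  forall K : set (M * M), compact K ->
    compact ((fun p : G * M => (A p.1 p.2, p.2)) @^-1` K).

Definition stabilizer (R : realType) (G : lie_group R) (M : manifold R)
    (A : smooth_action G M) (x : M) : set G := [set g | A g x = x].

(* xi_M (y) = d/dt exp(t xi) . y at t = 0.  The action is given as a plain
   function so that this also applies to the action of a subgroup of G on a
   slice (for xi in its Lie algebra). *)
Definition fundamental (R : realType) (G : lie_group R) (expG : exponential G)
    (M : manifold R) (a : G -> M -> M) (xi : Lie G) (y : M) : tangent y :=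
  velocity (fun t : R => a (expG (t *: xi)) y).

Definition invariant_vfield (R : realType) (G : lie_group R) (M : manifold R)
    (H : set G) (a : G -> M -> M) (X : vfield M) : Prop :=
  forall h y, H h -> X (a h y) = X y *m differential (a h) y.

(* The tangent space to the orbit of x is {xi_M(x)}. *)
Definition relative_equilibrium (R : realType) (G : lie_group R)
    (expG : exponential G) (M : manifold R) (A : smooth_action G M) (X : vfield M)
    (x : M) : Prop :=
  exists xi : Lie G, X x = fundamental expG A xi x.

Definition embedding (R : realType) (S M : manifold R) (i : S -> M) : Prop :=
  [/\ smooth_map i, injective i,
      forall y, row_free (differential i y) &
      forall U : set S, open U -> exists2 V : set M, open V & U = i @^-1` V].

(* (Q, p) is the associated bundle G x^H S = (G x S) / H, H acting by
   h . (g, s) = (g h^-1, h . s): a manifold Q with a surjective submersion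
   p : G x S -> Q whose fibres are the H-orbits, which determines Q up to a
   unique diffeomorphism. *)
Definition is_associated_bundle (R : realType) (G : lie_group R) (H : set G)
    (S : manifold R) (a : G -> S -> S) (Q : manifold R) (p : G -> S -> Q) :
    Prop :=
  [/\ smooth_map2 p,
      forall q, exists g s, p g s = q,
      forall g s, forall w, exists v, differential2 p g s v = w &
      forall g s g' s', p g s = p g' s' <->
        exists2 h, H h & g' = lg_mul g (lg_inv h) /\ s' = a h s].

(* A slice through x.  The embedded submanifold S of M is given as a manifold
   with an embedding into M; slice_act is the induced action of the stabilizer
   H of x (its values at group elements outside H are irrelevant). *)
Record slice (R : realType) (G : lie_group R) (M : manifold R)
    (A : smooth_action G M) (x : M) := Slice {
  slice_manifold :> manifold R;
  slice_incl : slice_manifold -> M;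
  slice_pt : slice_manifold;
  slice_act : G -> slice_manifold -> slice_manifold;
  slice_incl_embedding : embedding slice_incl;
  slice_incl_pt : slice_incl slice_pt = x;
  slice_actE : forall h y, stabilizer A x h ->
    slice_incl (slice_act h y) = A h (slice_incl y);
  slice_diffeo :
    exists (Q : manifold R) (p : G -> slice_manifold -> Q)
           (F : Q -> M) (F' : M -> Q),
      [/\ is_associated_bundle (stabilizer A x) slice_act p,
          forall g s, F (p g s) = A g (slice_incl s) &
          diffeo_on setT [set m | exists g s, m = A g (slice_incl s)] F F']
}.
Arguments slice_incl {R G M A x} s.
Arguments slice_pt {R G M A x} s.
Arguments slice_act {R G M A x} s.

(* U is an open H-invariant neighbourhood of x in the slice S, that is, a
   smaller slice through x. *)
Definition shrunk_slice (R : realType) (G : lie_group R) (M : manifold R)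
    (A : smooth_action G M) (x : M) (S : slice A x) (U : set S) : Prop :=
  [/\ open U, U (slice_pt S) &
      forall h y, stabilizer A x h -> U y -> U (slice_act S h y)].

(* XS(y) is the T_y S-component of X(y) in the decomposition
   T_y M = T_y S (+) {xi_M(y) : xi in m}. *)
Definition slice_component (R : realType) (G : lie_group R)
    (expG : exponential G) (M : manifold R) (A : smooth_action G M) (x : M)
    (S : slice A x) (m : {vspace Lie G}) (X : vfield M) (XS : vfield S) : Prop :=
  forall y : S, exists2 xi : Lie G, xi \in m &
    X (slice_incl S y) = XS y *m differential (slice_incl S) y
                         + fundamental expG A xi (slice_incl S y).

Definition slice_rep (R : realType) (G : lie_group R) (M : manifold R)
    (A : smooth_action G M) (x : M) (S : slice A x) (h : G) : 'M[R]_(mdim S) :=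
  differential (slice_act S h) (slice_pt S).

Definition slice_drep (R : realType) (G : lie_group R) (expG : exponential G)
    (M : manifold R) (A : smooth_action G M) (x : M) (S : slice A x) (xi : Lie G) :
    'M[R]_(mdim S) :=
  derive1 (fun t : R => slice_rep S (expG (t *: xi))) 0.

Definition equivariant_slice_map (R : realType) (G : lie_group R)
    (M : manifold R) (A : smooth_action G M) (x1 x2 : M)
    (S1 : slice A x1) (S2 : slice A x2) (U1 : set S1) (phi : S1 -> S2) : Prop :=
  exists2 g : G, A g x1 = x2 &
    forall h y, stabilizer A x1 h -> U1 y ->
      phi (slice_act S1 h y) = slice_act S2 (conjG g h) (phi y).

(* Z = Z' + psi_S on U for some smooth equivariant psi : U -> Lie(H). *)
Definition isomorphic_vfields (R : realType) (G : lie_group R)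
    (expG : exponential G) (M : manifold R) (A : smooth_action G M) (x : M)
    (S : slice A x) (U : set S) (Z Z' : vfield S) : Prop :=
  exists psi : S -> Lie G,
    [/\ smooth_vec U psi,
        forall y, U y -> sub_lie expG (stabilizer A x) (psi y),
        forall h y, stabilizer A x h -> U y ->
          psi (slice_act S h y) = Ad h (psi y) &
        forall y, U y -> Z y = Z' y + fundamental expG (slice_act S) (psi y) y].

Definition complexify (R : realType) (m n : nat) (A : 'M[R]_(m, n)) :
    'M[complex R]_(m, n) := map_mx (real_complex R) A.

(* L maps eigenvectors of A to eigenvectors of B, and the real parts of the
   corresponding eigenvalues agree: every eigenspace of A has a basis (the rows
   of P) mapped by L to eigenvectors of B whose eigenvalues have the same real
   part.  One cannot ask this of all vectors of the eigenspace at once: if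
   B = L^-1 A L + K with K commuting with B, an eigenspace of A of dimension at
   least 2 may be split by K into eigenspaces for distinct eigenvalues of B. *)
Definition maps_eigenvectors (R : realType) (m n : nat)
    (A : 'M[R]_m) (L : 'M[R]_(m, n)) (B : 'M[R]_n) : Prop :=
  forall a : complex R,
    exists P : 'M[complex R]_(\rank (eigenspace (complexify A) a), m),
      (P :=: eigenspace (complexify A) a)%MS /\
      forall i, exists b : complex R,
        [/\ complex.Re b = complex.Re a,
            row i P *m complexify L != 0 &
            row i P *m complexify L *m complexify B =
              b *: (row i P *m complexify L)].

(* Main.v *)
(* X^S vanishes at the base point s of a slice: the fibre of (g, y) |-> g . y
   through (1, s) is H x {s}, and (by a contraction argument) every vector in
   the kernel of the differential of a submersion is tangent to the fibre, so no
   nonzero vector of T_s S is tangent to the orbit.  Hence phi_*(X^{S1}) and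
   X^{S2} have linearizations at x2, namely T^{-1} D1 T and D2, and these differ
   by the linearization of psi_S.  Since psi takes values in h, the derivative of
   psi does not contribute at s, and the symmetry of second derivatives of the
   action turns the linearization of psi_S into K = delta rho (psi x2).
   The stabilizer is compact as the action is proper, so t |-> rho (exp t psi x2)
   is bounded, which forces K to be diagonalizable with imaginary eigenvalues.
   As K commutes with D2 by equivariance of X^{S2}, it diagonalizes on each
   eigenspace of D2 and of T^{-1} D1 T, shifting eigenvalues by imaginary
   numbers. *)
Require Import Defs.
From HB Require Import structures.
From mathcomp Require Import all_boot all_order all_algebra.
From mathcomp Require Import complex.
From mathcomp Require Import all_classical all_reals all_analysis.
From mathcomp Require Import ring lra.

Set Implicit Arguments.
Unset Strict Implicit.
Unset Printing Implicit Defensive.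

Import Order.TTheory GRing.Theory Num.Theory.
Import numFieldNormedType.Exports.

Local Open Scope classical_set_scope.
Local Open Scope ring_scope.

(** * Eigenvectors of commuting perturbations *)

(** A slice carries its induced action as a bare function compatible with the embedding, so every
    analytic property of that action is obtained in [M] and brought back: a map into the slice is
    differentiable as soon as its composite with the embedding is, and matrices are compared after
    multiplication by the differential of the embedding, which has full row rank. Tangent spaces are
    read in a chart selected at each point, so a field at neighbouring points is expressed in one
    fixed chart through transition Jacobians. These Jacobians are never differentiated, because
    every field linearized here vanishes at the base point: in a product [f *m B] with [f] zero
    there, only the differential of [f] and the value of [B] contribute, and continuity of [B] is
    enough. Bounded one-parameter groups are studied on single coordinates of orbits [u *m J t]: an
    eigenvalue off the imaginary axis would produce exponential growth in one direction of time, a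
    Jordan block linear growth. *)

Lemma horner_mx_prod_undup (F : fieldType) n (A : 'M[F]_n.+1) :
  (forall a (u : 'rV_n.+1),
     u *m (A - a%:M) *m (A - a%:M) = 0 -> u *m (A - a%:M) = 0) ->
  forall (rs : seq F) (q : {poly F}),
  horner_mx A (\prod_(r <- rs) ('X - r%:P) * q) = 0 ->
  horner_mx A (\prod_(r <- undup rs) ('X - r%:P) * q) = 0.
Proof.
move=> kerA; elim=> [|a rs IH] q //=.
rewrite big_cons -mulrA => h.
(* When [a] occurs again in [rs], the product contains the square of ['X - a%:P], which [kerA],
   applied row by row, lowers to the first power; otherwise the factor is moved into [q]. *)
case: ifPn => [ars|_].
  apply: IH; move: h; rewrite (big_rem a)//= -mulrA.
  set p := \prod_(_ <- _) _ * q.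
  have AX : horner_mx A ('X - a%:P) = A - a%:M.
    by rewrite rmorphB /= horner_mx_X horner_mx_C.
  have hM u v : horner_mx A (u * v) = horner_mx A u *m horner_mx A v.
    exact: rmorphM.
  rewrite mulrA [_ * _ * p]mulrC [('X - _) * p]mulrC !hM AX => h.
  apply/row_matrixP => i; rewrite row0 row_mul.
  by apply: kerA; rewrite -!row_mul -mulmxA h row0.
rewrite big_cons -mulrA mulrCA; apply: IH.
by rewrite mulrCA.
Qed.

(** The minimal polynomial splits, and the hypothesis excludes Jordan blocks of size at least two,
    so the product over its distinct roots already annihilates [A]. *)
Lemma closed_diagonalizable (F : closedFieldType) n (A : 'M[F]_n) :
  (forall a (u : 'rV_n),
     u *m (A - a%:M) *m (A - a%:M) = 0 -> u *m (A - a%:M) = 0) ->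
  mxred.diagonalizable A.
Proof.
case: n A => [|n] A kerA.
  by exists 1%:M; rewrite ?unitmx1//; apply/is_diag_mxP => -[].
apply/mxred.diagonalizableP.
have [rs prs] := closed_field_poly_normal (mxminpoly A).
exists (undup rs); first exact: undup_uniq.
apply: mxminpoly_min; rewrite -[X in horner_mx _ X]mulr1.
apply: horner_mx_prod_undup => //; rewrite mulr1.
move: (mx_root_minpoly A); rewrite {1}prs.
by rewrite (monicP (mxminpoly_monic A)) scale1r.
Qed.

Definition imaginary_semisimple (R : realType) n (K : 'M[R]_n) :=
  exists (P : 'M[complex R]_n) (d : 'rV[complex R]_n),
    [/\ P \in unitmx, P *m complexify K = diag_mx d *m P &
        forall j, complex.Re (d 0 j) = 0].

Lemma complexifyM (R : realType) m n p (A : 'M[R]_(m, n)) (B : 'M[R]_(n, p)) :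
  complexify (A *m B) = complexify A *m complexify B.
Proof. exact: map_mxM. Qed.

Lemma complexify1 (R : realType) n : complexify (1%:M : 'M[R]_n) = 1%:M.
Proof. exact: map_mx1. Qed.

(** The sizes [m] and [n] will be the dimensions of two different slices; comparing ranks gives
    [m = n], after which the conjugation is an ordinary square one. *)
Lemma imaginary_semisimple_conj (R : realType) n m (K : 'M[R]_n)
    (L : 'M[R]_(m, n)) (L' : 'M[R]_(n, m)) :
  L *m L' = 1%:M -> L' *m L = 1%:M ->
  imaginary_semisimple K -> imaginary_semisimple (L *m K *m L').
Proof.
move=> LL' L'L; have mn : m = n.
  apply/eqP; rewrite eqn_leq; apply/andP; split.
    by rewrite -{1}(mxrank1 R m) -LL' (leq_trans (mxrankM_maxl _ _))// rank_leq_col.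
  by rewrite -{1}(mxrank1 R n) -L'L (leq_trans (mxrankM_maxl _ _))// rank_leq_col.
subst m => -[P [d [Pu PK dI]]].
have L'u : L' \in unitmx by apply/(mulmx1_unit L'L).1.
exists (P *m complexify L'), d; split=> //.
  by rewrite unitmx_mul Pu map_unitmx.
rewrite !complexifyM !mulmxA -(mulmxA P) -complexifyM L'L complexify1 mulmx1.
by rewrite PK.
Qed.

Lemma imaginary_semisimpleN (R : realType) n (K : 'M[R]_n) :
  imaginary_semisimple K -> imaginary_semisimple (- K).
Proof.
move=> [P [d [Pu PK dI]]]; exists P, (- d); split=> //.
  by rewrite /complexify map_mxN mulmxN -/(complexify K) PK linearN mulNmx.
by move=> j; rewrite mxE raddfN /= dI oppr0.
Qed.

(** In the coordinates [V *m invmx P] the matrix becomes diagonal, and a diagonalizable matrix stays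
    diagonalizable on a stable subspace. The eigenvalues are exhibited as entries of [d] so that a
    property of all these entries passes to the subspace. *)
Lemma stable_eigenvector_basis (F : fieldType) m r (K P : 'M[F]_m)
    (d : 'rV[F]_m) (V : 'M[F]_(r, m)) :
  P \in unitmx -> P *m K = diag_mx d *m P -> row_free V -> stablemx V K ->
  exists2 W : 'M[F]_(r, m), (W :=: V)%MS &
    forall i, row i W != 0 /\ exists j, row i W *m K = d 0 j *: row i W.
Proof.
move=> Pu PK Vf stV.
have Pui : invmx P \in unitmx by rewrite unitmx_inv.
have Kd : K = mxred.conjmx (invmx P) (diag_mx d).
  by rewrite mxred.conjVmx// -mulmxA -PK mulKmx.
have stVP : stablemx (V *m invmx P) (diag_mx d).
  by apply: mxred.stablemx_comp; rewrite ?stablemx_unit// -Kd.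
have VPf : row_free (V *m invmx P).
  by rewrite /row_free mxrankMfree ?row_free_unit.
have [Q Qu /mxred.similar_diagPex[e]] := mxred.diagonalizable_conj_diag stVP VPf.
rewrite mxred.conjMumx// -?Kd// => /(mxred.similarP Qu) Qe.
have QVK : Q *m V *m K = diag_mx e *m (Q *m V).
  rewrite [RHS]mulmxA; have := congr1 (mulmx^~ V) Qe => /= <-.
  by rewrite -[RHS]mulmxA mulmxKpV ?mulmxA.
have QVf : row_free (Q *m V).
  by rewrite /row_free mxrankMfree// -/(row_free Q) row_free_unit.
exists (Q *m V); first by apply: eqmxMfull; rewrite row_full_unit.
move=> i; have rowK : row i (Q *m V) *m K = e 0 i *: row i (Q *m V).
  rewrite -row_mul QVK; apply/rowP => j.
  by move: (Q *m V) => M; rewrite mul_diag_mx !mxE.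
have row_neq0 : row i (Q *m V) != 0.
  apply/eqP => r0; move/row_freeP: QVf => [W QW].
  have /eqP := congr1 (fun M => row i M 0 i) QW.
  by rewrite row_mul r0 mul0mx !mxE eqxx eq_sym oner_eq0.
split=> //; set w := row i _ in rowK row_neq0 *.
have wP0 : w *m invmx P != 0.
  apply: contra_neq row_neq0 => w0.
  by rewrite -[w](mulmxKV Pu) w0 mul0mx.
(* An eigenvector has a nonzero coordinate in the eigenbasis [P]; comparing this coordinate on both
   sides identifies [e 0 i] with [d 0 j]. *)
have [j wj] : exists j, (w *m invmx P) 0 j != 0 by apply/rV0Pn.
exists j; rewrite rowK; congr (_ *: _).
have := congr1 (fun M => (M *m invmx P) 0 j) rowK.
rewrite /= -{1}[w](mulmxKV Pu) -mulmxA PK mulmxA mulmxK// mul_mx_diag.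
rewrite -scalemxAl [LHS]mxE [RHS]mxE [LHS]mulrC.
by move=> /(mulIf wj).
Qed.

(** A row [w] with [w A = a w] and [w K = d w] satisfies [(w L) B = w (A + K) L = (a + d) (w L)],
    and [L'] shows that [w L] is nonzero. Such rows form a basis of each eigenspace of [A], since
    [K] preserves it. *)
Lemma maps_eigenvectors_semisimple (R : realType) m n (A : 'M[R]_m)
    (L : 'M[R]_(m, n)) (L' : 'M[R]_(n, m)) (B : 'M[R]_n) (K : 'M[R]_m) :
  L *m L' = 1%:M -> L *m B = (A + K) *m L -> A *m K = K *m A ->
  imaginary_semisimple K -> maps_eigenvectors A L B.
Proof.
move=> LL' LB AK [P [d [Pu PK dI]]] a.
set E := eigenspace _ _.
have stE : stablemx E (complexify K).
  case: (m) A K AK @E {LB LL' Pu PK P d dI L L' B} => [|k] A K AK E.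
    by rewrite thinmx0 sub0mx.
  by apply: comm_mx_stable_eigenspace; rewrite /comm_mx -!complexifyM AK.
have stV : stablemx (row_base E) (complexify K) by rewrite stablemx_row_base.
have [W WV Wrow] := stable_eigenvector_basis Pu PK (row_base_free E) stV.
have WE := eqmx_trans WV (eq_row_base E).
exists W; split=> // i.
have [w_neq0 [j wK]] := Wrow i; exists (a + d 0 j); split.
- by rewrite raddfD /= (_ : complex.Re (d 0 j) = 0) ?addr0//; exact: dI.
- apply: contra_neq w_neq0 => w0.
  by rewrite -[row i W]mulmx1 -complexify1 -LL' complexifyM mulmxA w0 mul0mx.
- rewrite -mulmxA -complexifyM LB complexifyM mulmxA scalemxAl.
  rewrite /complexify map_mxD -/(complexify A) -/(complexify K) mulmxDr wK.
  have /eigenspaceP -> : (row i W <= eigenspace (complexify A) a)%MS.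
    by apply: submx_trans (row_sub i W) _; rewrite WE.
  by rewrite scalerDl.
Qed.
(** * Differential calculus *)

(* The complete and the normed module structures of matrices are in the library,
   but their join is not. *)
HB.instance Definition _ (R : realType) m n :=
  Uniform_isComplete.Build 'M[R]_(m, n) cauchy_cvg.

Lemma norm_coord_le (R : realType) m n (M : 'M[R]_(m, n)) i j : `|M i j| <= `|M|.
Proof. by rewrite [leRHS]mx_normrE; exact: (le_bigmax _ _ (i, j)). Qed.

Lemma mx_norm_leP (R : realType) m n (M : 'M[R]_(m, n)) (e : R) :
  0 <= e -> (forall i j, `|M i j| <= e) -> `|M| <= e.
Proof. by move=> e0 Me; rewrite [leLHS]mx_normrE; apply: bigmax_le => // -[i j] _; exact: Me. Qed.

Lemma norm_mulmx_le (R : realType) m n p (A : 'M[R]_(m, n)) (B : 'M[R]_(n, p)) :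
  `|A *m B| <= n%:R * (`|A| * `|B|).
Proof.
apply: mx_norm_leP; first by rewrite mulr_ge0 ?mulr_ge0.
move=> i j; rewrite mxE; apply: le_trans (ler_norm_sum _ _ _) _.
apply: (@le_trans _ _ (\sum_(k < n) (`|A| * `|B|))).
  by apply: ler_sum => k _; rewrite normrM ler_pM// norm_coord_le.
by rewrite sumr_const card_ord mulr_natl.
Qed.

Lemma mx_linear_continuous (R : realType) m n (W : normedModType R)
    (L : {linear 'M[R]_(m, n) -> W}) : continuous L.
Proof.
have LE M : L M = \sum_i \sum_j M i j *: L (delta_mx i j).
  rewrite {1}[M]matrix_sum_delta linear_sum; apply: eq_bigr => i _.
  by rewrite linear_sum; apply: eq_bigr => j _; rewrite linearZ.
apply: bounded_linear_continuous; apply/linear_boundedP.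
pose C := \sum_i \sum_j `|L (delta_mx i j)|.
exists C; split; first by rewrite num_real.
move=> r Cr M; rewrite LE; apply: (@le_trans _ _ (C * `|M|)); last first.
  by rewrite ler_wpM2r// ltW.
rewrite mulr_suml; apply: le_trans (ler_norm_sum _ _ _) _.
apply: ler_sum => i _; rewrite mulr_suml.
apply: le_trans (ler_norm_sum _ _ _) _; apply: ler_sum => j _.
by rewrite normrZ mulrC ler_wpM2l// norm_coord_le.
Qed.

Section Differentials.
Context {R : realType}.
Implicit Types V W : normedModType R.

Lemma diff_near V W (f : V -> W) (a : V) (e : R) : differentiable f a -> 0 < e ->
  \forall z \near a, `|f z - f a - 'd f a (z - a)| <= e * `|z - a|.
Proof.
move=> /diff_locallyP [_] /eqaddoP dfa e0.
have := dfa _ e0; rewrite near_simpl => h.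
rewrite (near_shift 0); near=> z.
rewrite /= subr0 addrK; have : `|f (z + a) - (f a + 'd f a z)| <= e * `|z|.
  by near: z.
by rewrite opprD addrA.
Unshelve. all: by end_near. Qed.

Lemma is_diff_near V W (f : V -> W) (a : V) (L : {linear V -> W}) :
  continuous L ->
  (forall e, 0 < e -> \forall z \near a, `|f z - f a - L (z - a)| <= e * `|z - a|) ->
  is_diff a f L.
Proof.
move=> Lc h.
have fE : f \o shift a = cst (f a) + L +o_ 0 id.
  apply/eqaddoP => e e0; have := h _ e0; rewrite (near_shift 0).
  apply: filterS => z; rewrite /= subr0 addrK !fctE /= => h2.
  by rewrite opprD addrA.
have dL := diff_unique Lc fE.
apply: DiffDef => //; apply/diff_locallyP; rewrite dL; split=> //.
Qed.

Lemma near_is_diff V W (f g df : V -> W) (a : V) :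
  (\forall z \near a, f z = g z) -> is_diff a f df -> is_diff a g df.
Proof.
move=> fg [dfa <-]; apply: is_diff_near; first exact: diff_continuous.
move=> e e0; have fga := nbhs_singleton fg.
near=> z; rewrite -fga -(near fg z)//.
by near: z; exact: diff_near.
Unshelve. all: by end_near. Qed.

Lemma near_differentiable V W (f g : V -> W) (a : V) :
  (\forall z \near a, f z = g z) -> differentiable f a -> differentiable g a.
Proof. by move=> fg /differentiableP/(near_is_diff fg)[]. Qed.

Lemma near_diffE V W (f g : V -> W) (a : V) :
  (\forall z \near a, f z = g z) -> differentiable f a ->
  'd f a = 'd g a :> (V -> W).
Proof. by move=> fg /differentiableP/(near_is_diff fg)[_ ->]. Qed.

Lemma differentiable_lipschitz_near V W (f : V -> W) (a : V) : differentiable f a ->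
  exists2 k : R, 0 < k & \forall z \near a, `|f z - f a| <= k * `|z - a|.
Proof.
move=> dfa; have [r [r0 Lr]] : exists r, 0 < r /\ forall v, `|'d f a v| <= r * `|v|.
  have /linear_bounded_continuous/linear_boundedP [y [yr h]] := diff_continuous dfa.
  exists (`|y| + 1); split; first by rewrite ltr_wpDl.
  by apply: h; rewrite (le_lt_trans (ler_norm _))// ltrDl.
exists (r + 1); first by rewrite ltr_wpDr// ltW.
near=> z; have h : `|f z - f a - 'd f a (z - a)| <= 1 * `|z - a|.
  by near: z; exact: diff_near.
rewrite mul1r in h.
rewrite -[f z - f a](subrK ('d f a (z - a))) (le_trans (ler_normD _ _))//.
by rewrite mulrDl mul1r addrC lerD.
Unshelve. all: by end_near. Qed.

(* Continuity of [B] suffices because [f] vanishes at [a]. *)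
Lemma is_diff_mulmx0 V m n (f : V -> 'rV[R]_m) (B : V -> 'M[R]_(m, n)) (a : V) :
  differentiable f a -> f a = 0 -> {for a, continuous B} ->
  is_diff a (fun x => f x *m B x) (fun v => 'd f a v *m B a).
Proof.
move=> dfa fa0 cB.
have -> : (fun v => 'd f a v *m B a) = mulmxr (B a) \o 'd f a by [].
apply: is_diff_near => [x|e e0].
  apply: continuous_comp; first exact: diff_continuous.
  exact: mx_linear_continuous.
have [k k0 fk] := differentiable_lipschitz_near dfa.
rewrite fa0 in fk.
(* The two error terms are at most [m k (e / M) |z - a|] and [m (e / M) |B a| |z - a|]; the added
   [1] keeps [M] positive when [m] is zero. *)
set M := m%:R * (`|B a| + k) + 1.
have M0 : 0 < M by rewrite ltr_wpDl// mulr_ge0// addr_ge0// ltW.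
have eM : 0 < e / M by rewrite divr_gt0.
near=> z.
have -> : f z *m B z - f a *m B a - (mulmxr (B a) \o 'd f a) (z - a) =
  f z *m (B z - B a) + (f z - f a - 'd f a (z - a)) *m B a.
  by rewrite /= fa0 mul0mx !subr0 mulmxBr mulmxBl addrA subrK.
apply: le_trans (ler_normD _ _) _.
apply: (@le_trans _ _ (m%:R * (k * `|z - a| * (e / M)) + m%:R * (e / M * `|z - a| * `|B a|))).
  apply: lerD; apply: le_trans (norm_mulmx_le _ _) _; rewrite ler_wpM2l//; apply: ler_pM => //.
  - by rewrite -[f z]subr0; near: z.
  - rewrite distrC; near: z; exact: cvgr_dist_le.
  - by near: z; exact: diff_near.
rewrite (_ : _ + _ = m%:R * (`|B a| + k) * (e / M) * `|z - a|); last by ring.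
rewrite ler_wpM2r// mulrA ler_pdivrMr// mulrC ler_wpM2l ?ltW//.
by rewrite ltrDl.
Unshelve. all: by end_near. Qed.
End Differentials.

(** * Mean values and functions of class C^k *)

Section Calculus.
Context {R : realType}.
Implicit Types V W : normedModType R.

Lemma is_derive_diff_comp V W (f : V -> W) (g : R -> V) (t : R) (w : V) :
  differentiable f (g t) -> is_derive t 1 g w ->
  is_derive t 1 (f \o g) ('d f (g t) w).
Proof.
move=> df [/derivable1_diffP dg gw].
have dfg : differentiable (f \o g) t by exact: differentiable_comp.
apply: DeriveDef; first exact/derivable1_diffP.
by rewrite deriveE// diff_comp//= -(deriveE _ dg) gw.
Qed.

Lemma is_derive_line V (a w : V) (t : R) :
  is_derive t 1 (fun s : R => a + s *: w) w.
Proof.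
have h : is_derive t 1 ( *:%R^~ w) w.
  have dw : differentiable ( *:%R^~ w : R -> V) t by [].
  apply: DeriveDef; first exact/derivable1_diffP.
  by rewrite deriveE// diff_val scale1r.
have := is_deriveD (is_derive_cst a t 1) h; rewrite add0r.
by congr is_derive; apply/funext => s.
Qed.

Lemma segment_MVT V (f : V -> R) (a w : V) :
  (forall t : R, 0 <= t <= 1 -> differentiable f (a + t *: w)) ->
  exists2 t : R, 0 < t < 1 & f (a + w) - f a = 'd f (a + t *: w) w.
Proof.
move=> df; pose g (t : R) := f (a + t *: w).
have dg (t : R) : 0 <= t <= 1 -> is_derive t 1 g ('d f (a + t *: w) w).
  by move=> /df d; apply: is_derive_diff_comp => //; exact: is_derive_line.
have [] := @MVT R g (fun t => 'd f (a + t *: w) w) 0 1 ltr01.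
- by move=> t; rewrite in_itv /= => /andP[t0 t1]; apply: dg; rewrite !ltW.
- apply: derivable_within_continuous => t; rewrite in_itv /= => /dg [].
  by [].
move=> t; rewrite in_itv /= => t01; rewrite subr0 mulr1 /g.
by rewrite scale1r scale0r addr0 => ->; exists t.
Qed.

Lemma Cr_eq V W k (U : set V) (f g : V -> W) : open U ->
  (forall x, U x -> f x = g x) -> Cr k U f -> Cr k U g.
Proof.
move=> oU; elim: k f g => [|k IH] f g fg /=.
  move=> cf x Ux; rewrite /prop_for /continuous_at -fg//.
  apply: cvg_trans (cf x Ux); apply: near_eq_cvg.
  by near=> z; rewrite fg//; near: z; exact: open_nbhs_nbhs.
have ne x : U x -> \forall z \near x, f z = g z.
  by move=> Ux; near=> z; apply: fg; near: z; exact: open_nbhs_nbhs.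
move=> [df h]; split=> [x Ux|v].
  by apply: near_differentiable (ne _ Ux) _; exact: df.
apply: IH (h v) => x Ux; have := near_diffE (ne _ Ux) (df _ Ux).
by move=> /(congr1 (fun F => F v)).
Unshelve. all: by end_near. Qed.

Lemma is_diff_coord V n (f : V -> 'rV[R]_n) (a : V) (j : 'I_n) :
  differentiable f a ->
  is_diff a (fun x => f x 0 j : R) (fun v => 'd f a v 0 j).
Proof.
move=> df; have dc := @differentiable_coord R 1 n (f a) 0 j.
have h := differentiable_comp df dc; split=> //.
have cL : linear (fun M : 'rV[R]_n => M 0 j : R) by move=> k u v; rewrite !mxE.
pose L := GRing.isLinear.Build _ _ _ _ (fun M : 'rV[R]_n => M 0 j : R) cL.
pose LL : {linear 'rV[R]_n -> R} := HB.pack (fun M : 'rV[R]_n => M 0 j : R) L.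
have LLc := @mx_linear_continuous R 1 n R LL.
rewrite -[fun x => f x 0 j]/(LL \o f) diff_comp//.
by rewrite (diff_lin _ LLc).
Qed.

Lemma Cr_coord V n k (U : set V) (f : V -> 'rV[R]_n) (j : 'I_n) : open U ->
  Cr k U f -> Cr k U (fun x => f x 0 j : R).
Proof.
move=> oU; elim: k f => [|k IH] f /=.
  move=> cf x Ux; apply: (@continuous_comp _ _ _ f (fun M : 'rV[R]_n => M 0 j)); first exact: cf.
  exact: coord_continuous.
move=> [df h]; split=> [x Ux|v]; first by have [] := is_diff_coord j (df x Ux).
apply: (Cr_eq oU _ (IH _ (h v))) => x Ux.
by have [_ ->] := is_diff_coord j (df x Ux).
Qed.

End Calculus.

(** * Symmetry of second derivatives *)

Section Schwarz.
Context {R : realType}.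
Implicit Types V : normedModType R.

Lemma is_diff_shift V (a c : V) : is_diff a (fun x => x + c) id.
Proof.
have h := is_diffD (is_diff_id a) (is_diff_cst c a).
rewrite addr0 in h; rewrite (_ : (fun _ => _) = id + cst c)//.
Qed.

(** The mean value theorem is applied twice to the increment over a parallelogram: along [v] to
    [x |-> F (x + s w) - F x], then along [w] to [x |-> 'd F x v]. *)
Lemma second_difference V (F : V -> R) (U : set V) (a v w : V) (s : R) :
  Cr 2 U F ->
  (forall t1 t2 : R, 0 <= t1 <= 1 -> 0 <= t2 <= 1 ->
     U (a + t1 *: (s *: v) + t2 *: (s *: w))) ->
  exists t1 t2 : R, [/\ 0 < t1 < 1, 0 < t2 < 1 &
    F (a + s *: v + s *: w) - F (a + s *: v) - (F (a + s *: w) - F a) =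
    s * (s * 'd (fun x => 'd F x v) (a + t1 *: (s *: v) + t2 *: (s *: w)) w)].
Proof.
move=> [dF ddF] hU.
have dG (t : R) : 0 <= t <= 1 -> is_diff (a + t *: (s *: v)) (fun x => F (x + s *: w) - F x)
    ('d F (a + t *: (s *: v) + s *: w) \- 'd F (a + t *: (s *: v))).
  move=> t01; apply: (@is_diffB _ _ _ (fun x => F (x + s *: w)) F).
    have := is_diff_shift (a + t *: (s *: v)) (s *: w).
    move=> h; apply: (@is_diff_comp _ _ _ _ (fun x => x + s *: w) id F).
    apply: differentiableP; apply: dF; rewrite -[X in _ + X]scale1r.
    by apply: hU => //; rewrite ler01 lexx.
  apply: differentiableP; apply: dF; rewrite -[X in U X]addr0 -[X in _ + X](scale0r (s *: w)).
  by apply: hU => //; rewrite lexx ler01.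
have [t1 t101 e1] : exists2 t : R, 0 < t < 1 &
    F (a + s *: v + s *: w) - F (a + s *: v) - (F (a + s *: w) - F a) =
    s * ('d F (a + t *: (s *: v) + s *: w) v - 'd F (a + t *: (s *: v)) v).
  have [t t01|t t01 ->] := @segment_MVT _ _ (fun x => F (x + s *: w) - F x) a (s *: v).
    by have [] := dG t t01.
  exists t => //; have [_ ->] : is_diff (a + t *: (s *: v)) (fun x => F (x + s *: w) - F x)
    ('d F (a + t *: (s *: v) + s *: w) \- 'd F (a + t *: (s *: v))).
    by apply: dG; case/andP: t01 => t0 t1; rewrite !ltW.
  by rewrite /= mulrBr; congr (_ - _); exact: linearZ.
have t101' : 0 <= t1 <= 1 by case/andP: t101 => t0 t1'; rewrite !ltW.
have [dH _] := ddF v.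
have [t t01|t2 t201 e2] := @segment_MVT _ _ (fun x => 'd F x v) (a + t1 *: (s *: v)) (s *: w).
  exact/dH/hU.
by exists t1, t2; split=> //; rewrite e1 e2; congr (_ * _); exact: linearZ.
Qed.

(** The second difference over the parallelogram spanned by [s v] and [s w] is symmetric in [v] and
    [w], so the two mixed derivatives agree, though at two different intermediate points; continuity
    of both derivatives brings these points back to [a]. *)
Lemma schwarz V (F : V -> R) (U : set V) (a v w : V) : open U -> U a -> Cr 2 U F ->
  'd (fun x => 'd F x v) a w = 'd (fun x => 'd F x w) a v.
Proof.
move=> oU Ua CF; have [_ ddF] := CF.
have cvw := (ddF v).2 w a Ua; have cwv := (ddF w).2 v a Ua.
apply/eqP; rewrite -subr_eq0 -normr_le0; apply/ler_addgt0Pr => e e0; rewrite add0r.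
have e20 : 0 < e / 2 by rewrite divr_gt0.
have [d d0 hd] : exists2 d : R, 0 < d & forall z, `|a - z| < d ->
    [/\ U z, `|'d (fun x => 'd F x v) a w - 'd (fun x => 'd F x v) z w| <= e / 2
      & `|'d (fun x => 'd F x w) a v - 'd (fun x => 'd F x w) z v| <= e / 2].
  have : \forall z \near a, [/\ U z,
      `|'d (fun x => 'd F x v) a w - 'd (fun x => 'd F x v) z w| <= e / 2
      & `|'d (fun x => 'd F x w) a v - 'd (fun x => 'd F x w) z v| <= e / 2].
    near=> z; split; near: z.
    - exact: open_nbhs_nbhs.
    - exact: cvgr_dist_le.
    - exact: cvgr_dist_le.
  by move=> /nbhs_normP[d /= d0 h]; exists d => // z zd; apply: h.
have D0 : 0 < `|v| + `|w| + 1 by rewrite ltr_wpDl// addr_ge0.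
have [s s0 sd] : exists2 s : R, 0 < s & s * (`|v| + `|w|) < d.
  exists (d / (`|v| + `|w| + 1)); first by rewrite divr_gt0.
  by rewrite mulrAC ltr_pdivrMr// ltr_pM2l// ltrDl.
have near_a v' w' (t1 t2 : R) : `|v'| + `|w'| = `|v| + `|w| -> 0 <= t1 <= 1 -> 0 <= t2 <= 1 ->
    `|a - (a + t1 *: (s *: v') + t2 *: (s *: w'))| < d.
  move=> vw /andP[t10 t11] /andP[t20 t21].
  rewrite -addrA opprD addrA subrr add0r normrN.
  apply: le_lt_trans (ler_normD _ _) _; rewrite !normrZ.
  rewrite (ger0_norm t10) (ger0_norm t20) (gtr0_norm s0).
  apply: le_lt_trans sd; rewrite -vw mulrDr.
  by apply: lerD; rewrite ler_piMl// mulr_ge0// ltW.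
have [|t1 [t2 [t101 t201 e1]]] := @second_difference _ F U a v w s CF.
  by move=> t1 t2 h1 h2; have [] := hd _ (near_a v w t1 t2 erefl h1 h2).
have [|u1 [u2 [u101 u201 e2]]] := @second_difference _ F U a w v s CF.
  by move=> u1 u2 h1 h2; have [] := hd _ (near_a w v u1 u2 (addrC _ _) h1 h2).
have wk (t : R) : 0 < t < 1 -> 0 <= t <= 1 by case/andP=> ? ?; rewrite !ltW.
have [_ h1 _] := hd _ (near_a v w t1 t2 erefl (wk _ t101) (wk _ t201)).
have [_ _ h2] := hd _ (near_a w v u1 u2 (addrC _ _) (wk _ u101) (wk _ u201)).
have E : 'd (fun x => 'd F x v) (a + t1 *: (s *: v) + t2 *: (s *: w)) w =
         'd (fun x => 'd F x w) (a + u1 *: (s *: w) + u2 *: (s *: v)) v.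
  have sn0 : s != 0 by rewrite gt_eqF.
  apply: (mulfI sn0); apply: (mulfI sn0); rewrite -e1 -e2.
  rewrite [a + s *: w + s *: v]addrAC; ring.
rewrite E in h1; rewrite -(subrKA ('d (fun x => 'd F x w) (a + u1 *: (s *: w) + u2 *: (s *: v)) v)).
rewrite (le_trans (ler_normD _ _))// [leRHS]splitr lerD//.
by rewrite distrC.
Unshelve. all: by end_near. Qed.

Lemma schwarz_rV V n (f : V -> 'rV[R]_n) (U : set V) (a v w : V) :
  open U -> U a -> Cr 2 U f ->
  'd (fun x => 'd f x v) a w = 'd (fun x => 'd f x w) a v.
Proof.
move=> oU Ua Cf; apply/rowP => j.
have h u z : 'd (fun x => 'd f x u) a z 0 j = 'd (fun x => 'd (fun y => f y 0 j : R) x u) a z.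
  have d2 : differentiable (fun x => 'd f x u) a by have [_ /(_ u) [h _]] := Cf; exact: h.
  have [d2j /(congr1 (fun F => F z)) <-] := is_diff_coord j d2.
  have /near_diffE/(_ d2j)/(congr1 (fun F => F z)) // : \forall x \near a,
    'd f x u 0 j = 'd (fun y => f y 0 j : R) x u.
  near=> x; have dfx : differentiable f x.
    by apply: Cf.1; near: x; exact: open_nbhs_nbhs.
  by have [_ ->] := is_diff_coord j dfx.
by rewrite !h; apply: (schwarz _ _ oU Ua); exact: Cr_coord.
Unshelve. all: by end_near. Qed.

End Schwarz.

(** * Fibres of submersions *)

Section Graves.
Context {R : realType}.
Implicit Types V : normedModType R.

Lemma contraction_half_fixed n (Phi : 'rV[R]_n -> 'rV[R]_n) (r : R) :
  0 <= r -> (forall k, `|k| <= r -> `|Phi k| <= r) ->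
  (forall k k', `|k| <= r -> `|k'| <= r -> `|Phi k - Phi k'| <= 2^-1 * `|k - k'|) ->
  exists2 k, `|k| <= r & k = Phi k.
Proof.
move=> r0 Pr Pc; pose U0 : set 'rV[R]_n := [set k | `|k| <= r].
have PU : {homo Phi : x / U0 x >-> U0 x} by move=> x /Pr.
pose P : {fun U0 >-> U0} := HB.pack Phi (isFun.Build _ _ U0 U0 Phi PU).
have h : is_contraction P.
  exists (2^-1)%:nng; split=> /=; first by rewrite invf_lt1 ?ltr1n.
  by move=> [k k'] [/= hk hk'] /=; exact: Pc.
have [||k kr kP] := banach_fixed_point h.
- rewrite (_ : U0 = (Num.norm : 'rV[R]_n -> R) @^-1` [set x | x <= r])//.
  by apply: preimage_closed => [k _|]; [exact: norm_continuous|exact: closed_le].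
- by exists 0; rewrite /U0 /= normr0.
by exists k.
Qed.

(* The points of the fibre are the fixed points of the Newton-type iteration
   k |-> k - (f (b + B k) - f a), with b = a + t w and B a right inverse of the
   differential at a. *)
Lemma submersion_fibre_tangent V n (f : V -> 'rV[R]_n) (U : set V) (a w : V) (e : R) :
  open U -> U a -> Cr 1 U f -> (forall y, exists v, 'd f a v = y) ->
  'd f a w = 0 -> 0 < e ->
  \forall t \near (0 : R), exists2 u,
    U u /\ f u = f a & `|u - (a + t *: w)| <= e * `|t|.
Proof.
move=> oU Ua [df cdf] surj dw e0.
have dfa := df a Ua.
pose b (j : 'I_n) : V := sval (cid (surj (delta_mx 0 j))).
have bE j : 'd f a (b j) = delta_mx 0 j by rewrite /b; case: cid.
pose B (k : 'rV[R]_n) : V := \sum_j k 0 j *: b j.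
have BB k k' : B (k - k') = B k - B k'.
  rewrite /B -sumrB; apply: eq_bigr => j _.
  by rewrite !mxE scalerBl.
pose C := \sum_j `|b j|.
have C0 : 0 <= C by apply: sumr_ge0.
have BC k : `|B k| <= C * `|k|.
  rewrite mulr_suml; apply: le_trans (ler_norm_sum _ _ _) _.
  apply: ler_sum => j _; rewrite normrZ mulrC ler_wpM2l//.
  exact: norm_coord_le.
have B0 : B 0 = 0 by rewrite -[in LHS](subrr 0) BB subrr.
(* If each ['d f z (b j)] is within [q] of the unit vector, then [n q <= 1/2] makes ['d f z \o B]
   differ from the identity by a map of norm at most 1/2, the future contraction constant. *)
have [q q0 nq] : exists2 q : R, 0 < q & n%:R * q <= 2^-1.
  exists (2^-1 / n.+1%:R); first by rewrite divr_gt0 ?invr_gt0.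
  by rewrite mulrA ler_pdivrMr// mulrC ler_wpM2l ?invr_ge0// ler_nat.
have [d d0 hd] : exists2 d : R, 0 < d & forall z, `|a - z| < d ->
    U z /\ forall j, `|'d f z (b j) - delta_mx 0 j| <= q.
  have : \forall z \near a, U z /\ forall j, `|'d f z (b j) - delta_mx 0 j| <= q.
    near=> z; split; first by near: z; exact: open_nbhs_nbhs.
    near: z; apply: filter_forall => j; near=> z.
    rewrite -bE distrC; near: z; apply: cvgr_dist_le => //.
    by have := cdf (b j) a Ua.
  by move=> /nbhs_normP[d /= d0 h]; exists d => // z zd; apply: h.
have dB z h : `|a - z| < d -> `|'d f z (B h) - h| <= 2^-1 * `|h|.
  move=> /hd [_ hz].
  have -> : 'd f z (B h) - h = \sum_j h 0 j *: ('d f z (b j) - delta_mx 0 j).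
    rewrite {2}[h]row_sum_delta linear_sum -sumrB; apply: eq_bigr => j _.
    by rewrite linearZ scalerBr.
  apply: le_trans (ler_norm_sum _ _ _) _.
  apply: (@le_trans _ _ (\sum_(j < n) (`|h| * q))).
    by apply: ler_sum => j _; rewrite normrZ ler_pM// norm_coord_le.
  by rewrite sumr_const card_ord -[leLHS]mulr_natl mulrCA [leRHS]mulrC ler_wpM2l.
have ctr c k k' : (forall s : R, 0 <= s <= 1 -> `|a - (c + B k' + s *: B (k - k'))| < d) ->
    `|(k - f (c + B k)) - (k' - f (c + B k'))| <= 2^-1 * `|k - k'|.
  move=> hc; apply: mx_norm_leP; first by rewrite mulr_ge0.
  move=> i j; rewrite ord1 {i}.
  (* The mean value theorem is used one coordinate at a time; the intermediate point [s] may depend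
     on [j] because the norm is the maximum of the entries. *)
  have [s s01|s s01 es] := @segment_MVT _ _ (fun x => f x 0 j) (c + B k') (B (k - k')).
    by have [] := is_diff_coord j (df _ (hd _ (hc s s01)).1).
  have s01' : 0 <= s <= 1 by case/andP: s01 => ? ?; rewrite !ltW.
  have [_ dj] := is_diff_coord j (df _ (hd _ (hc s s01')).1).
  rewrite dj in es.
  rewrite (_ : _ 0 j = - ('d f (c + B k' + s *: B (k - k')) (B (k - k')) - (k - k')) 0 j).
    rewrite normrN; apply: le_trans (dB _ _ (hc s s01')).
    exact: norm_coord_le.
  have kk : c + B k' + B (k - k') = c + B k by rewrite BB -addrA subrKC.
  by rewrite kk in es; rewrite [in RHS]mxE -es !mxE; ring.
(* Chosen to give [C r <= e |t|] below, where [r] is twice the norm of [f c - f a], itself at most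
   [(e / D) |t| (|w| + 1)] because [w] lies in the kernel; the added ones keep [D] positive. *)
pose D := 2 * (C + 1) * (`|w| + 1).
have D0 : 0 < D by rewrite mulr_gt0 ?mulr_gt0 ?ltr_wpDl ?addr_ge0.
have eD : 0 < e / D by rewrite divr_gt0.
have De : D * (e / D) = e by rewrite mulrC divfK// gt_eqF.
have w1 : 0 < `|w| + 1 by rewrite ltr_wpDl.
have we : 0 < `|w| + 1 + e by rewrite addr_gt0.
have [d1 d10 hd1] : exists2 d1 : R, 0 < d1 & forall z, `|a - z| < d1 ->
    `|f z - f a - 'd f a (z - a)| <= e / D * `|z - a|.
  have /nbhs_normP[d1 /= d10 h] := diff_near dfa eD.
  by exists d1 => // z zd; apply: h.
near=> t.
have tw : `|t *: w| <= `|t| * (`|w| + 1) by rewrite normrZ ler_wpM2l// lerDl.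
pose c := a + t *: w.
have fc : `|f c - f a| <= e / D * (`|t| * (`|w| + 1)).
  have ac : `|a - c| < d1.
    rewrite /c opprD addrA subrr add0r normrN (le_lt_trans tw)//.
    rewrite -ltr_pdivlMr//; near: t.
    by apply: (nbhs0_lt (V := R)); rewrite divr_gt0.
  have := hd1 _ ac; rewrite /c [a + _ - a]addrAC subrr add0r linearZ /= dw scaler0 subr0.
  by move=> /le_trans; apply; rewrite ler_wpM2l// ltW.
(* The first iterate [Phi 0] has norm [r / 2], so a map that contracts by 1/2 sends the ball of
   radius [r] into itself. *)
pose r := 2 * `|f c - f a|.
have r0 : 0 <= r by rewrite mulr_ge0.
have Cr_le : C * r <= e * `|t|.
  apply: (@le_trans _ _ ((C + 1) * (2 * (e / D * (`|t| * (`|w| + 1)))))).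
    by apply: ler_pM => //; rewrite ?lerDl// /r ler_pM2l.
  rewrite (_ : (C + 1) * _ = D * (e / D) * `|t|); last by rewrite /D; ring.
  by rewrite De.
have inball k : `|k| <= r -> `|a - (c + B k)| < d.
  move=> kr; rewrite /c -addrA opprD addrA subrr add0r normrN.
  apply: le_lt_trans (ler_normD _ _) _.
  apply: (@le_lt_trans _ _ (`|t| * (`|w| + 1) + e * `|t|)).
    by rewrite lerD// (le_trans (BC k))// (le_trans _ Cr_le)// ler_wpM2l.
  rewrite [e * _]mulrC -mulrDr -ltr_pdivlMr//.
  by near: t; apply: (nbhs0_lt (V := R)); rewrite divr_gt0// addr_gt0.
have seg k k' : `|k| <= r -> `|k'| <= r -> forall s : R, 0 <= s <= 1 ->
    `|a - (c + B k' + s *: B (k - k'))| < d.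
  move=> kr kr' s /andP[s0 s1].
  have -> : c + B k' + s *: B (k - k') = c + B ((1 - s) *: k' + s *: k).
    rewrite -addrA; congr (_ + _); rewrite /B scaler_sumr -big_split /=.
    by apply: eq_bigr => j _; rewrite scalerA -scalerDl !mxE; congr (_ *: _); ring.
  apply: inball; apply: le_trans (ler_normD _ _) _.
  rewrite !normrZ (ger0_norm s0) ger0_norm ?subr_ge0//.
  rewrite (_ : r = (1 - s) * r + s * r); last by ring.
  by apply: lerD; rewrite ler_wpM2l// subr_ge0.
have n0 : `|0 : 'rV[R]_n| <= r by rewrite normr0.
(* Taking [k] as the unknown keeps the iteration in ['rV[R]_n], which is complete, while [V] is an
   arbitrary normed space. *)
pose Phi (k : 'rV[R]_n) := k - (f (c + B k) - f a).
have PhiB k k' : Phi k - Phi k' = (k - f (c + B k)) - (k' - f (c + B k')).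
  by rewrite /Phi; apply/rowP => j; rewrite !mxE; ring.
have PhiC k k' : `|k| <= r -> `|k'| <= r -> `|Phi k - Phi k'| <= 2^-1 * `|k - k'|.
  by move=> kr kr'; rewrite PhiB; apply: ctr; exact: seg.
have [k kr kP] : exists2 k, `|k| <= r & k = Phi k.
  apply: contraction_half_fixed => // k kr.
  rewrite -[Phi k](subrK (Phi 0)) (le_trans (ler_normD _ _))//.
  have -> : r = 2^-1 * r + `|f c - f a| by rewrite /r; field.
  apply: lerD; first by rewrite (le_trans (PhiC _ _ kr n0))// subr0 ler_wpM2l.
  by rewrite /Phi sub0r normrN B0 addr0.
exists (c + B k); last first.
  by rewrite /c addrAC subrr add0r (le_trans (BC k))// (le_trans _ Cr_le)// ler_wpM2l.
split; first by have [] := hd _ (inball k kr).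
apply/eqP; rewrite -subr_eq0; apply/eqP.
move: kP; rewrite /Phi => /eqP; rewrite -subr_eq0 opprB addrCA subrr addr0.
by move/eqP.
Unshelve. all: by end_near. Qed.

End Graves.
(** * Bounded one-parameter groups *)

Section OneParameterGroups.
Context {R : realType}.

Lemma is_derive_linear m n (W : normedModType R) (L : 'M[R]_(m, n) -> W)
    (J : R -> 'M[R]_(m, n)) (t : R) (K : 'M[R]_(m, n)) :
  linear L -> is_derive t 1 J K -> is_derive t 1 (fun s => L (J s)) (L K).
Proof.
move=> linL dJ.
pose L0 := GRing.isLinear.Build _ _ _ _ L linL.
pose L1 : {linear 'M[R]_(m, n) -> W} := HB.pack L L0.
have Lc := @mx_linear_continuous R m n W L1.
have := @is_derive_diff_comp R _ _ L1 J t K (linear_differentiable _ Lc) dJ.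
by rewrite (diff_lin _ Lc).
Qed.

(** Writing [J s = J (s - t) *m J t] carries the derivative from [0] to [t]. The result is stated
    for single coordinates, to which the real product rule applies. *)
Lemma one_parameter_derive n (J : R -> 'M[R]_n) (K : 'M[R]_n) :
  (forall s t, J (s + t) = J s *m J t) -> is_derive (0 : R) (1 : R) J K ->
  forall (u : 'rV[R]_n) j (t : R),
  is_derive t (1 : R) (fun s => (u *m J s) 0 j : R) ((u *m K *m J t) 0 j).
Proof.
move=> Jadd [/derivable1_diffP dJ JK] u j t.
have dJt : is_derive t (1 : R) (fun s => J (s - t)) K.
  have st : is_derive t (1 : R) (fun s : R => s - t) 1.
    by apply: is_derive_eq; rewrite subr0.
  have dJ0 : differentiable J (t - t) by rewrite subrr.
  have := @is_derive_diff_comp _ _ _ J (fun s : R => s - t) t 1 dJ0 st.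
  by rewrite subrr -deriveE// JK.
have linL : linear (fun M : 'M[R]_n => (u *m M *m J t) 0 j : R).
  by move=> a A B; rewrite mulmxDr mulmxDl -scalemxAr -scalemxAl !mxE.
have := is_derive_linear linL dJt.
congr is_derive; apply/funext => s.
by rewrite -mulmxA -Jadd subrK.
Qed.

Lemma unbounded_linear (a b C : R) : (forall s, 0 <= s -> b + a * s <= C) -> a <= 0.
Proof.
move=> h; rewrite leNgt; apply/negP => a0.
have := h ((`|C| + `|b| + 1) / a)
  (divr_ge0 (addr_ge0 (addr_ge0 (normr_ge0 _) (normr_ge0 _)) ler01) (ltW a0)).
rewrite mulrC divfK ?gt_eqF// => h1.
have := ler_norm C; have := lerNnormlW (lexx `|b|); lra.
Qed.

Section Bounded.
Variables (n : nat) (J : R -> 'M[R]_n) (K : 'M[R]_n) (C : R).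
Hypothesis Jadd : forall s t, J (s + t) = J s *m J t.
Hypothesis J0 : J 0 = 1%:M.
Hypothesis dJ : is_derive (0 : R) (1 : R) J K.
Hypothesis JC : forall t, `|J t| <= C.

Let cD (x y : 'rV[R]_n) (M : 'M[R]_n) j :
  ((x + y) *m M) 0 j = (x *m M) 0 j + (y *m M) 0 j.
Proof. by rewrite mulmxDl; move: (_ *m _) (_ *m _) => p q; rewrite mxE. Qed.

Let cN (x : 'rV[R]_n) (M : 'M[R]_n) j : ((- x) *m M) 0 j = - (x *m M) 0 j.
Proof. by rewrite mulNmx; move: (_ *m _) => p; rewrite mxE. Qed.

Let cZ (k : R) (x : 'rV[R]_n) (M : 'M[R]_n) j :
  ((k *: x) *m M) 0 j = k * (x *m M) 0 j.
Proof. by rewrite -scalemxAl; move: (_ *m _) => p; rewrite mxE. Qed.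

Lemma bounded_orbit (u : 'rV[R]_n) : exists2 D : R, 0 <= D & forall t j, `|(u *m J t) 0 j| <= D.
Proof.
exists (n%:R * (`|u| * C)).
  by rewrite mulr_ge0// mulr_ge0// (le_trans _ (JC 0)).
move=> t j; apply: le_trans (norm_coord_le _ _ _) _.
apply: le_trans (norm_mulmx_le _ _) _.
by rewrite ler_wpM2l// ler_wpM2l.
Qed.

(** The hypotheses say that [u + i v] is an eigenvector for [a + i b]. Along its orbit the squared
    modulus [S] of each coordinate satisfies [S' = 2 a S], so it is an exponential, and a bounded
    one only if [a = 0] or [S 0 = 0]. *)
Lemma one_parameter_eigen_imaginary (u v : 'rV[R]_n) (a b : R) :
  u *m K = a *: u - b *: v -> v *m K = b *: u + a *: v ->
  a = 0 \/ (u = 0 /\ v = 0).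
Proof.
move=> uK vK; have [|a0] := eqVneq a 0; [by left|right].
suff h j : (u 0 j) ^+ 2 + (v 0 j) ^+ 2 = 0.
  split; apply/rowP => j; rewrite mxE; apply/eqP; rewrite -sqrf_eq0 eq_le sqr_ge0 andbT.
    by have := h j; have := sqr_ge0 (v 0 j); lra.
  by have := h j; have := sqr_ge0 (u 0 j); lra.
pose f (t : R) : R := (u *m J t) 0 j.
pose g (t : R) : R := (v *m J t) 0 j.
have df t : is_derive t (1 : R) f (a * f t - b * g t).
  have := one_parameter_derive Jadd dJ u j t.
  by rewrite uK !(cD, cN, cZ).
have dg t : is_derive t (1 : R) g (b * f t + a * g t).
  have := one_parameter_derive Jadd dJ v j t.
  by rewrite vK !(cD, cN, cZ).
pose S (t : R) : R := f t * f t + g t * g t.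
have dS t : is_derive t (1 : R) S (2 * a * S t).
  apply: is_derive_eq (is_deriveD (is_deriveM (df t) (df t)) (is_deriveM (dg t) (dg t))) _.
  by rewrite /S /=; move: (f t) (g t) => p q; rewrite /GRing.scale /=; ring.
have SE t : S t = S 0 * expR (2 * a * t).
  have dE (s : R) : is_derive s (1 : R) (fun s => S s * expR (- (2 * a * s))) 0.
    apply: is_derive_eq; rewrite /GRing.scale /=; ring.
  have := is_derive_0_is_cst t 0 dE; rewrite mulr0 oppr0 expR0 mulr1 => <-.
  by rewrite -mulrA -expRD addNr expR0 mulr1.
have [D1 D10 hD1] := bounded_orbit u.
have [D2 D20 hD2] := bounded_orbit v.
have SD t : S t <= D1 * D1 + D2 * D2.
  by apply: lerD; rewrite (le_trans (ler_norm _))// normrM ler_pM// ?hD1 ?hD2.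
have S00 : 0 <= S 0 by rewrite addr_ge0// -expr2 sqr_ge0.
have S0 : S 0 <= 0.
  (* At time [s / (2 a)], whatever the sign of [a], [S] equals [S 0 * exp s], which is at least
     [S 0 * (1 + s)]. *)
  apply: (@unbounded_linear _ (S 0) (D1 * D1 + D2 * D2)) => s s0.
  apply: le_trans (SD (s / (2 * a))); rewrite (SE (s / _)).
  have -> : 2 * a * (s / (2 * a)) = s by rewrite mulrC divfK// mulf_neq0.
  rewrite -{1}[S 0]mulr1 -mulrDr ler_wpM2l//; exact: expR_ge1Dx.
by apply/eqP; have := S00; rewrite eq_le; move: S0; rewrite /S /f /g J0 !mulmx1 -!expr2 => -> ->.
Qed.

(* Along the orbits, Re (z conj z1) has constant derivative |z1|^2, where
   z = u + i v and z1 = u1 + i v1, so boundedness forces z1 = 0. *)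
Lemma one_parameter_eigen_semisimple (u v u1 v1 : 'rV[R]_n) (b : R) :
  u *m K = u1 - b *: v -> v *m K = b *: u + v1 ->
  u1 *m K = - (b *: v1) -> v1 *m K = b *: u1 ->
  u1 = 0 /\ v1 = 0.
Proof.
move=> uK vK u1K v1K.
suff h j : (u1 0 j) ^+ 2 + (v1 0 j) ^+ 2 = 0.
  split; apply/rowP => j; rewrite mxE; apply/eqP; rewrite -sqrf_eq0 eq_le sqr_ge0 andbT.
    by have := h j; have := sqr_ge0 (v1 0 j); lra.
  by have := h j; have := sqr_ge0 (u1 0 j); lra.
pose f (w : 'rV[R]_n) (t : R) : R := (w *m J t) 0 j.
have df w t : is_derive t (1 : R) (f w) ((w *m K *m J t) 0 j).
  exact: one_parameter_derive.
have du (t : R) : is_derive t (1 : R) (f u) (f u1 t - b * f v t).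
  by have := df u t; rewrite uK !(cD, cN, cZ).
have dv (t : R) : is_derive t (1 : R) (f v) (b * f u t + f v1 t).
  by have := df v t; rewrite vK !(cD, cN, cZ).
have du1 (t : R) : is_derive t (1 : R) (f u1) (- (b * f v1 t)).
  by have := df u1 t; rewrite u1K !(cD, cN, cZ).
have dv1 (t : R) : is_derive t (1 : R) (f v1) (b * f u1 t).
  by have := df v1 t; rewrite v1K !(cD, cN, cZ).
pose S (t : R) : R := f u1 t * f u1 t + f v1 t * f v1 t.
(* [u1 + i v1] is an eigenvector for the imaginary number [i b], so the modulus of each coordinate
   is constant along its orbit. *)
have SE t : S t = S 0.
  apply: is_derive_0_is_cst => s.
  apply: is_derive_eq (is_deriveD (is_deriveM (du1 s) (du1 s)) (is_deriveM (dv1 s) (dv1 s))) _.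
  by move: (f u1 s) (f v1 s) => p q; rewrite /GRing.scale /=; ring.
have gE t : f u t * f u1 t + f v t * f v1 t - t * S 0 = f u 0 * f u1 0 + f v 0 * f v1 0.
  have dG (s : R) : is_derive s (1 : R) (fun s => f u s * f u1 s + f v s * f v1 s - s * S 0) 0.
    apply: is_derive_eq (is_deriveB
      (is_deriveD (is_deriveM (du s) (du1 s)) (is_deriveM (dv s) (dv1 s)))
      (is_deriveM (is_derive_id s 1) (is_derive_cst (S 0) s 1))) _.
    rewrite -(SE s) /S /cst; move: (f u s) (f v s) (f u1 s) (f v1 s) => p q p1 q1.
    by rewrite /GRing.scale /=; ring.
  by have := is_derive_0_is_cst t 0 dG; rewrite mul0r subr0.
have [D1 D10 hD1] := bounded_orbit u.
have [D2 D20 hD2] := bounded_orbit v.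
have [D3 D30 hD3] := bounded_orbit u1.
have [D4 D40 hD4] := bounded_orbit v1.
have S00 : 0 <= S 0 by rewrite addr_ge0// -expr2 sqr_ge0.
have S0 : S 0 <= 0.
  apply: (@unbounded_linear _ (f u 0 * f u1 0 + f v 0 * f v1 0) (D1 * D3 + D2 * D4)) => s s0.
  rewrite -(gE s) [S 0 * s]mulrC subrK.
  apply: le_trans (ler_norm _) _; apply: le_trans (ler_normD _ _) _.
  by apply: lerD; rewrite normrM ler_pM// /f ?hD1 ?hD2 ?hD3 ?hD4.
by apply/eqP; have := S00; rewrite eq_le; move: S0; rewrite /S /f J0 !mulmx1 -!expr2 => -> ->.
Qed.

Let ReM (w : 'rV[complex R]_n) : 'rV[R]_n := map_mx (@complex.Re R) w.
Let ImM (w : 'rV[complex R]_n) : 'rV[R]_n := map_mx (@complex.Im R) w.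

Let ReImE w w' : ReM w = ReM w' -> ImM w = ImM w' -> w = w'.
Proof.
move=> /rowP re /rowP im; apply/rowP => j.
by have := re j; have := im j; rewrite !mxE; case: (w 0 j) (w' 0 j) => a b [c d] /= -> ->.
Qed.

Let ReMK w : ReM (w *m complexify K) = ReM w *m K.
Proof.
apply/rowP => j; rewrite !mxE raddf_sum; apply: eq_bigr => i _.
by rewrite !mxE; case: (w 0 i) => a b /=; rewrite mulr0 subr0.
Qed.

Let ImMK w : ImM (w *m complexify K) = ImM w *m K.
Proof.
apply/rowP => j; rewrite !mxE raddf_sum; apply: eq_bigr => i _.
by rewrite !mxE; case: (w 0 i) => a b /=; rewrite mulr0 add0r.
Qed.

Let ReMZ a w : ReM (a *: w) = complex.Re a *: ReM w - complex.Im a *: ImM w.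
Proof. by apply/rowP => j; rewrite !mxE; case: a (w 0 j) => a b [c d]. Qed.

Let ImMZ a w : ImM (a *: w) = complex.Im a *: ReM w + complex.Re a *: ImM w.
Proof. by apply/rowP => j; rewrite !mxE addrC; case: a (w 0 j) => a b [c d]. Qed.

Let ReMD w w' : ReM (w + w') = ReM w + ReM w'.
Proof. by apply/rowP => j; rewrite !mxE raddfD. Qed.

Let ImMD w w' : ImM (w + w') = ImM w + ImM w'.
Proof. by apply/rowP => j; rewrite !mxE raddfD. Qed.

Let eigen_Re (w : 'rV[complex R]_n) (a : complex R) :
  w *m complexify K = a *: w -> w != 0 -> complex.Re a = 0.
Proof.
move=> wK; have /= := @one_parameter_eigen_imaginary (ReM w) (ImM w) (complex.Re a) (complex.Im a).
rewrite -ReMK -ImMK wK ReMZ ImMZ => /(_ erefl erefl) [//|[re im]].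
move/eqP; case; apply: ReImE; rewrite ?re ?im; apply/rowP => j; by rewrite !mxE.
Qed.

(** By [closed_diagonalizable] it suffices to exclude Jordan blocks. If [w1 = w (K - a)] is killed
    by [K - a] and nonzero, it is an eigenvector, so [a] is imaginary, and the real and imaginary
    parts of [w] and [w1] then satisfy the hypotheses of [one_parameter_eigen_semisimple] with
    [b = Im a]. *)
Lemma bounded_generator_imaginary_semisimple : imaginary_semisimple K.
Proof.
have Bc (w : 'rV_n) (a : complex R) : w *m (complexify K - a%:M) = w *m complexify K - a *: w.
  by rewrite mulmxBr mul_mx_scalar.
have := @closed_diagonalizable (complex R) n (complexify K); case.
  move=> a w w2; set w1 := w *m _ in w2 *.
  have w1K : w1 *m complexify K = a *: w1.
    by apply/eqP; rewrite -subr_eq0 -Bc w2.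
  apply/eqP/negPn/negP => w1n0; have a0 := eigen_Re w1K w1n0.
  have wK : w *m complexify K = w1 + a *: w by rewrite /w1 Bc subrK.
  have [] := @one_parameter_eigen_semisimple (ReM w) (ImM w) (ReM w1) (ImM w1) (complex.Im a).
  - by rewrite -ReMK wK ReMD ReMZ a0 scale0r sub0r.
  - by rewrite -ImMK wK ImMD ImMZ a0 scale0r addr0 addrC.
  - by rewrite -ReMK w1K ReMZ a0 scale0r sub0r.
  - by rewrite -ImMK w1K ImMZ a0 scale0r addr0.
  move=> re im; move/eqP: w1n0; apply; apply: ReImE; rewrite ?re ?im;
  by apply/rowP => j; rewrite !mxE.
move=> P Pu /mxred.similar_diagPex[d /(mxred.similarP Pu) PK].
exists P, d; split=> // j.
have rK : row j P *m complexify K = d 0 j *: row j P.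
  by rewrite -row_mul PK row_mul row_diag_mx -scalemxAl -rowE.
apply: eigen_Re rK _; apply/eqP => r0.
have := row_mul j P (invmx P); rewrite r0 mul0mx mulmxV// => /rowP/(_ j).
by rewrite !mxE eqxx => /eqP; rewrite oner_eq0.
Qed.

End Bounded.

End OneParameterGroups.
(** * Derivatives in charts *)

Section ChartCalculus.
Context {R : realType}.

Lemma jacobianE n m (f : 'rV[R]_n -> 'rV[R]_m) p v : v *m jacobian f p = 'd f p v.
Proof. by rewrite /jacobian mul_rV_lin1. Qed.

Lemma jacobian_comp n m k (f : 'rV[R]_n -> 'rV[R]_m) (g : 'rV[R]_m -> 'rV[R]_k) p :
  differentiable f p -> differentiable g (f p) ->
  jacobian (g \o f) p = jacobian f p *m jacobian g (f p).
Proof.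
move=> df dg; apply/row_matrixP => i.
by rewrite !rowE mulmxA !jacobianE diff_comp.
Qed.

Lemma jacobian_near n m (f g : 'rV[R]_n -> 'rV[R]_m) p :
  (\forall z \near p, f z = g z) -> differentiable f p ->
  jacobian f p = jacobian g p.
Proof.
move=> fg df; apply/row_matrixP => i.
rewrite [LHS]rowE [RHS]rowE [LHS]jacobianE [RHS]jacobianE.
exact: (congr1 (fun F => F (delta_mx 0 i)) (near_diffE fg df)).
Qed.

Lemma cvg_mx_coord (T : topologicalType) m n (F : T -> 'M[R]_(m, n)) (a : T) :
  (forall i j, {for a, continuous (fun x => F x i j : R)}) ->
  {for a, continuous F}.
Proof.
move=> cF; apply/cvgrPdist_le => e e0.
have : \forall x \near a, forall ij : 'I_m * 'I_n, `|F a ij.1 ij.2 - F x ij.1 ij.2| <= e.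
  apply: filter_forall => -[i j] /=.
  by have /cvgrPdist_le/(_ e e0) := cF i j.
apply: filterS => x h; apply: mx_norm_leP; first exact: ltW.
by move=> i j; rewrite !mxE; exact: (h (i, j)).
Qed.

Lemma continuous_jacobian n m (U : set 'rV[R]_n) (f : 'rV[R]_n -> 'rV[R]_m) p :
  Cr 1 U f -> U p -> {for p, continuous (jacobian f)}.
Proof.
move=> [_ cf] Up; apply: cvg_mx_coord => i j.
have := cf (delta_mx 0 i) p Up => h.
have := @continuous_comp _ _ _ _ (fun M : 'rV[R]_m => M 0 j) p h (@coord_continuous _ _ _ 0 j _).
congr continuous_at; apply/funext => x.
by rewrite /jacobian mxE.
Qed.

Lemma chart_inv_cvg (T : topologicalType) n (c : chart R T n) (y : T) :
  chart_dom c y -> cinv c p @[p --> c y] --> y.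
Proof.
move=> cy; have cc : {for c y, continuous (cinv c)} by apply: cinv_cont; exists y.
by rewrite /prop_for /continuous_at cmapK in cc.
Qed.

Lemma chart_inv_near (T : topologicalType) n (c : chart R T n) (y : T) (P : set T) :
  chart_dom c y -> (\forall z \near y, P z) -> \forall p \near c y, P (cinv c p).
Proof.
by move=> cy Py; exact: (chart_inv_cvg cy).
Qed.

Lemma chart_dom_near (T : topologicalType) n (c : chart R T n) (y : T) :
  chart_dom c y -> \forall z \near y, chart_dom c z.
Proof. by move=> cy; apply: open_nbhs_nbhs; split=> //; exact: chart_dom_open. Qed.

Lemma chart_invK_near (T : topologicalType) n (c : chart R T n) (y : T) :
  chart_dom c y -> \forall p \near c y, chart_dom c (cinv c p) /\ c (cinv c p) = p.
Proof.
move=> cy; have : \forall p \near c y, (c @` chart_dom c) p.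
  by apply: open_nbhs_nbhs; split; [exact: cmap_open|exists y].
by apply: filterS => p [z cz <-]; rewrite cmapK.
Qed.

(** The charts are free parameters because those used by [differential] change with the point.
    [differential] is the case of the selected charts and [tcoord] the case of the identity map, so
    one chain rule covers derivatives and changes of coordinates. *)
Definition mderiv (M N : manifold R) (c : chart R M (mdim M)) (d : chart R N (mdim N))
    (f : M -> N) (y : M) : 'M[R]_(mdim M, mdim N) :=
  jacobian (d \o f \o cinv c) (c y).

(** Continuity is a separate clause: [d] takes arbitrary values outside its domain, so
    differentiability of the chart expression does not by itself keep [f] inside that domain near
    [y]. *)
Definition mdifferentiable (M N : manifold R) (f : M -> N) (y : M) :=
  {for y, continuous f} /\
  forall c d, atlas M c -> atlas N d -> chart_dom c y -> chart_dom d (f y) ->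
    differentiable (d \o f \o cinv c) (c y).

Lemma smooth_in_mdifferentiable (M N : manifold R) (U : set M) (f : M -> N) y :
  U y -> smooth_in U f -> mdifferentiable f y.
Proof.
move=> Uy [cf sf]; split; first exact: cf.
move=> c d ac ad cy dfy; have [h _] := sf c d ac ad 1%N.
by apply: h; exists y => //; split.
Qed.

Lemma mdifferentiable_comp (M N P : manifold R) (f : M -> N) (g : N -> P) y :
  mdifferentiable f y -> mdifferentiable g (f y) -> mdifferentiable (g \o f) y.
Proof.
move=> [cf df] [cg dg]; split; first exact: continuous_comp.
move=> c e ac ae cy egf; pose d := @chart_at R N (f y).
have dd : chart_dom d (f y) := chart_at_dom (f y).
have ad : atlas N d := chart_at_atlas (f y).
have D1 := df c d ac ad cy dd; have D2 := dg d e ad ae dd egf.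
have := @differentiable_comp _ _ _ _ (d \o f \o cinv c) (e \o g \o cinv d) (c y) D1.
rewrite /= cmapK// => /(_ D2); apply: near_differentiable.
have := chart_inv_near cy (cf _ (chart_dom_near dd)).
by apply: filterS => p dp /=; rewrite cmapK.
Qed.

Lemma mderiv_comp (M N P : manifold R) (f : M -> N) (g : N -> P) y c d e :
  mdifferentiable f y -> mdifferentiable g (f y) ->
  atlas M c -> atlas N d -> atlas P e ->
  chart_dom c y -> chart_dom d (f y) -> chart_dom e (g (f y)) ->
  mderiv c e (g \o f) y = mderiv c d f y *m mderiv d e g (f y).
Proof.
move=> [cf df] [cg dg] ac ad ae cy dd egf.
have D1 := df c d ac ad cy dd; have D2 := dg d e ad ae dd egf.
have E : (d \o f \o cinv c) (c y) = d (f y) by rewrite /= cmapK.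
have D2' : differentiable (e \o g \o cinv d) ((d \o f \o cinv c) (c y)) by rewrite E.
rewrite /mderiv -E -(jacobian_comp D1 D2').
symmetry; apply: jacobian_near; last exact: differentiable_comp.
have := chart_inv_near cy (cf _ (chart_dom_near dd)).
by apply: filterS => p dp /=; rewrite cmapK.
Qed.

Lemma mderiv_near (M N : manifold R) (f g : M -> N) y c d :
  (\forall z \near y, f z = g z) -> mdifferentiable f y ->
  atlas M c -> atlas N d -> chart_dom c y -> chart_dom d (f y) ->
  mderiv c d f y = mderiv c d g y.
Proof.
move=> fg [cf df] ac ad cy df'; apply: jacobian_near; last exact: df.
have := chart_inv_near cy fg.
by apply: filterS => p /= ->.
Qed.

Lemma mdifferentiable_id (M : manifold R) (y : M) : mdifferentiable id y.
Proof.
split; first by [].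
move=> c d ac ad cy dy; have [h _] := atlas_compat ac ad 1%N.
by apply: h; exists y.
Qed.

Lemma mderiv_id (M : manifold R) (c : chart R M (mdim M)) (y : M) :
  chart_dom c y -> mderiv c c id y = 1%:M.
Proof.
move=> cy; have := @jacobian_near _ _ id (c \o id \o cinv c) (c y).
rewrite /mderiv => <- //.
  by apply/row_matrixP => i; rewrite !rowE jacobianE diff_val mulmx1.
by have := chart_invK_near cy; apply: filterS => p [].
Qed.

Lemma differentialE (M N : manifold R) (f : M -> N) (y : M) :
  differential f y = mderiv (chart_at y) (chart_at (f y)) f y.
Proof. by []. Qed.

Lemma tcoordE (M : manifold R) c (y : M) (v : tangent y) :
  tcoord c v = v *m mderiv (chart_at y) c id y.
Proof. by []. Qed.

Lemma tcoord_chart_at (M : manifold R) (y : M) (v : tangent y) :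
  tcoord (chart_at y) v = v.
Proof. by rewrite tcoordE mderiv_id ?mulmx1//; exact: chart_at_dom. Qed.

Lemma tcoordD (M : manifold R) c (y : M) (u v : tangent y) :
  @tcoord R M c y (u + v) = @tcoord R M c y u + @tcoord R M c y v.
Proof. exact: mulmxDl. Qed.

Lemma tcoord_differential (M N : manifold R) (f : M -> N) (y : M) (v : tangent y) c d :
  mdifferentiable f y -> atlas M c -> atlas N d -> chart_dom c y -> chart_dom d (f y) ->
  @tcoord R N d (f y) (v *m differential f y) = tcoord c v *m mderiv c d f y.
Proof.
move=> df ac ad cy dy; have idy := mdifferentiable_id y.
rewrite !tcoordE differentialE -!mulmxA; congr (_ *m _).
rewrite -mderiv_comp//;
  try solve [exact: chart_at_dom|exact: chart_at_atlas|exact: mdifferentiable_id].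
by rewrite -mderiv_comp//;
  try solve [exact: chart_at_dom|exact: chart_at_atlas|exact: mdifferentiable_id].
Qed.

Lemma curve_push (M N : manifold R) (f : M -> N) (gam : R -> M) (t : R) (w : 'rV[R]_(mdim M)) c d :
  {for t, continuous gam} -> mdifferentiable f (gam t) ->
  atlas M c -> atlas N d -> chart_dom c (gam t) -> chart_dom d (f (gam t)) ->
  is_derive t (1 : R) (fun s => c (gam s)) w ->
  is_derive t (1 : R) (fun s => d (f (gam s))) (w *m mderiv c d f (gam t)).
Proof.
move=> cg [cf df] ac ad cy dy dw.
have D := df c d ac ad cy dy; rewrite jacobianE.
have := @is_derive_diff_comp _ _ _ (d \o f \o cinv c) (fun s => c (gam s)) t w D dw.
apply: near_eq_is_derive.
have h := cg _ (chart_dom_near cy).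
by near=> s; rewrite /= cmapK//; near: s; exact: h.
Unshelve. all: by end_near. Qed.

End ChartCalculus.

(** * Maps of two variables in charts *)

Section TwoVariables.
Context {R : realType}.
Variables (G M P : manifold R) (A : G -> M -> P).
Hypothesis sA : smooth_map2 A.

Definition local2 (c : chart R G (mdim G)) (d : chart R M (mdim M))
    (e : chart R P (mdim P)) (q : 'rV[R]_(mdim G) * 'rV[R]_(mdim M)) :=
  e (A (cinv c q.1) (cinv d q.2)).

Definition dom2 (c : chart R G (mdim G)) (d : chart R M (mdim M))
    (e : chart R P (mdim P)) : set ('rV[R]_(mdim G) * 'rV[R]_(mdim M)) :=
  (fun q : G * M => (c q.1, d q.2)) @`
    [set q : G * M | [/\ chart_dom c q.1, chart_dom d q.2 & chart_dom e (A q.1 q.2)]].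

Lemma cvg_act2 (T : topologicalType) (F : set_system T) (FF : Filter F)
    (f : T -> G) (h : T -> M) g y :
  f x @[x --> F] --> g -> h x @[x --> F] --> y ->
  A (f x) (h x) @[x --> F] --> A g y.
Proof.
move=> fg hy; have [cA _] := sA.
exact: (cvg_comp _ _ (cvg_pair fg hy) (cA (g, y))).
Qed.

(** Lets [schwarz_rV] and [submersion_fibre_tangent], which are stated over open sets, be applied to
    [local2]. *)
Lemma dom2_open c d e : open (dom2 c d e).
Proof.
rewrite openE => _ [[g y] /= [cg dy eA] <-]; rewrite /interior.
have c1 : cinv c q.1 @[q --> (c g, d y)] --> g.
  apply: (@cvg_comp _ _ _ fst (cinv c) _ (nbhs (c g))); first exact: cvg_fst.
  exact: chart_inv_cvg.
have c2 : cinv d q.2 @[q --> (c g, d y)] --> y.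
  apply: (@cvg_comp _ _ _ snd (cinv d) _ (nbhs (d y))); first exact: cvg_snd.
  exact: chart_inv_cvg.
have cA := cvg_act2 _ c1 c2.
have k1 := @cvg_fst _ _ (nbhs (c g)) (nbhs (d y)) _ _ (chart_invK_near cg).
have k2 := @cvg_snd _ _ (nbhs (c g)) (nbhs (d y)) _ _ (chart_invK_near dy).
have eN := cA _ _ (chart_dom_near eA).
near=> q.
have [h1 h1'] : chart_dom c (cinv c q.1) /\ c (cinv c q.1) = q.1 by near: q; exact: k1.
have [h2 h2'] : chart_dom d (cinv d q.2) /\ d (cinv d q.2) = q.2 by near: q; exact: k2.
exists (cinv c q.1, cinv d q.2) => /=; last by rewrite h1' h2' -surjective_pairing.
split=> //; near: q; exact: eN.
Unshelve. all: by end_near. Qed.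

Variables (c : chart R G (mdim G)) (d : chart R M (mdim M)) (e : chart R P (mdim P)).
Hypotheses (ac : atlas G c) (ad : atlas M d) (ae : atlas P e).

Lemma dom2_mem g y : chart_dom c g -> chart_dom d y -> chart_dom e (A g y) ->
  dom2 c d e (c g, d y).
Proof. by move=> cg dy eA; exists (g, y). Qed.

Lemma smooth_local2 : smooth_on (dom2 c d e) (local2 c d e).
Proof. by have [_] := sA; apply. Qed.

Lemma is_derive_local2 (gam : R -> G) (bet : R -> M) (t : R) xi v :
  {for t, continuous gam} -> {for t, continuous bet} ->
  chart_dom c (gam t) -> chart_dom d (bet t) -> chart_dom e (A (gam t) (bet t)) ->
  is_derive t (1 : R) (fun s => c (gam s)) xi ->
  is_derive t (1 : R) (fun s => d (bet s)) v ->
  is_derive t (1 : R) (fun s => e (A (gam s) (bet s)))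
    ('d (local2 c d e) (c (gam t), d (bet t)) (xi, v)).
Proof.
move=> cg cb cgt dbt eA [/derivable1_diffP dg gx] [/derivable1_diffP db bv].
have [D _] := smooth_local2 1%N.
have {}D := D _ (dom2_mem cgt dbt eA).
have pd : is_derive t (1 : R) (fun s => (c (gam s), d (bet s))) (xi, v).
  have dp := differentiable_pair dg db.
  apply: DeriveDef; first exact/derivable1_diffP.
  by rewrite deriveE// diff_pair//= -(deriveE _ dg) -(deriveE _ db) gx bv.
have := @is_derive_diff_comp _ _ _ (local2 c d e) (fun s => (c (gam s), d (bet s))) t (xi, v) D pd.
apply: near_eq_is_derive.
have h1 := cg _ (chart_dom_near cgt); have h2 := cb _ (chart_dom_near dbt).
near=> s; rewrite /= /local2 /= !cmapK//.
  by near: s; exact: h2.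
by near: s; exact: h1.
Unshelve. all: by end_near. Qed.

Lemma mdifferentiable_partial2 g y : mdifferentiable (A g) y.
Proof.
split.
  by apply: (cvg_act2 _ (f := fun=> g) (h := id)); [exact: cvg_cst|exact: cvg_id].
move=> d' e' ad' ae' dy eA.
pose c' := @chart_at R G g.
have [_ /(_ c' d' e' (chart_at_atlas g) ad' ae' 1%N) [D _]] := sA.
have {}D := D (c' g, d' y); have /D {}D : dom2 c' d' e' (c' g, d' y).
  by exists (g, y) => //; split=> //; exact: chart_at_dom.
have dp : differentiable (fun p : 'rV[R]_(mdim M) => (c' g, p)) (d' y).
  exact: differentiable_pair.
have -> : e' \o A g \o cinv d' = local2 c' d' e' \o (fun p => (c' g, p)).
  by apply/funext => p; rewrite /local2 /= cmapK//; exact: chart_at_dom.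
exact: differentiable_comp.
Qed.

Lemma mderiv_partial2 g y v :
  chart_dom c g -> chart_dom d y -> chart_dom e (A g y) ->
  v *m mderiv d e (A g) y = 'd (local2 c d e) (c g, d y) (0, v).
Proof.
move=> cg dy eA; rewrite jacobianE.
have [D _] := smooth_local2 1%N; have {}D := D _ (dom2_mem cg dy eA).
have dp : differentiable (fun p : 'rV[R]_(mdim M) => (c g, p)) (d y).
  exact: differentiable_pair.
have -> : e \o A g \o cinv d = local2 c d e \o (fun p => (c g, p)).
  by apply/funext => p; rewrite /local2 /= cmapK.
rewrite diff_comp//= diff_pair//= diff_val.
by rewrite diff_val.
Qed.

End TwoVariables.
(** * Immersions and embeddings *)

Section Immersions.
Context {R : realType}.

(** A one-sided inverse [L] of the Jacobian recovers the increment of [j] from that of [f \o j], up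
    to a remainder that is small relative to the increment of [j] itself. Absorbing it first shows
    that [j] is Lipschitz at [a], and then that the remainder is [o(z - a)]. *)
Lemma differentiable_immersion_lift (V : normedModType R) m n (j : V -> 'rV[R]_m)
    (f : 'rV[R]_m -> 'rV[R]_n) (a : V) :
  {for a, continuous j} -> differentiable f (j a) ->
  row_free (jacobian f (j a)) -> differentiable (f \o j) a ->
  differentiable j a.
Proof.
move=> cj df /row_freeP [L JL] dfj.
pose D := 'd (f \o j) a.
pose C := n%:R * `|L| + 1.
have C0 : 0 < C by rewrite ltr_wpDl// mulr_ge0.
have LC (x : 'rV[R]_n) : `|x *m L| <= C * `|x|.
  rewrite (le_trans (norm_mulmx_le _ _))// mulrCA mulrC ler_wpM2r//.
  by rewrite lerDl.
have [k k0 hk] := differentiable_lipschitz_near dfj.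
pose E := 2 * C * k.
have E0 : 0 < E by rewrite mulr_gt0// mulr_gt0.
suff [] : is_diff a j (mulmxr L \o D) by [].
apply: is_diff_near => [x|eps eps0].
  apply: continuous_comp; first exact: diff_continuous.
  exact: mx_linear_continuous.
(* The bound by 1/2 absorbs the remainder in the Lipschitz estimate with constant [E]; the other
   bound makes the same remainder at most [eps / 2] times [|z - a|] afterwards. *)
have [e1 [e10 e1C e1E]] : exists e1 : R, [/\ 0 < e1, C * e1 <= 2^-1 & C * e1 * E <= eps / 2].
  exists (Num.min (2^-1 / C) (eps / 2 / (C * E))); split.
  - by rewrite lt_min !divr_gt0 ?invr_gt0 ?mulr_gt0.
  - by rewrite mulrC -ler_pdivlMr// ge_min lexx.
  - by rewrite mulrAC mulrC -ler_pdivlMr ?mulr_gt0// ge_min lexx orbT.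
have [e2 e20 e2C] : exists2 e2 : R, 0 < e2 & C * e2 = eps / 2.
  exists (eps / 2 / C); first by rewrite !divr_gt0.
  by rewrite mulrC divfK// gt_eqF.
have near1 : \forall z \near a, `|f (j z) - f (j a) - 'd f (j a) (j z - j a)| <= e1 * `|j z - j a|.
  exact: (cj _ (diff_near df e10)).
near=> z.
have r1 : `|f (j z) - f (j a) - 'd f (j a) (j z - j a)| <= e1 * `|j z - j a|.
  by near: z; exact: near1.
have r2 : `|f (j z) - f (j a) - D (z - a)| <= e2 * `|z - a|.
  by near: z; exact: (diff_near dfj e20).
have FE : `|f (j z) - f (j a)| <= k * `|z - a| by near: z; exact: hk.
rewrite -jacobianE in r1.
set d := j z - j a in r1 *; set F := f (j z) - f (j a) in r1 r2 FE *.
have dE : d = (F - (F - d *m jacobian f (j a))) *m L.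
  by rewrite subKr -mulmxA JL mulmx1.
have d_le : `|d| <= E * `|z - a|.
  have : `|d| <= C * `|F| + 2^-1 * `|d|.
    rewrite {1}dE (le_trans (LC _))// (le_trans (ler_wpM2l (ltW C0) (ler_normB _ _)))//.
    rewrite mulrDr lerD2l (le_trans (ler_wpM2l (ltW C0) r1))//.
    by rewrite mulrA ler_wpM2r.
  have : C * `|F| <= C * (k * `|z - a|) by rewrite ler_pM2l.
  rewrite /E; move: (`|d|) (`|F|) (`|z - a|) => p q r.
  by rewrite !mulrA => h1 h2; lra.
have -> : d - (mulmxr L \o D) (z - a) = ((F - D (z - a)) - (F - d *m jacobian f (j a))) *m L.
  by rewrite opprB [X in _ = X *m _]addrC subrKA mulmxBl -mulmxA JL mulmx1.
rewrite (le_trans (LC _))// (le_trans (ler_wpM2l (ltW C0) (ler_normB _ _)))//.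
rewrite [leLHS]mulrDr [X in _ <= X * _]splitr [leRHS]mulrDl; apply: lerD.
  by rewrite -e2C -mulrA ler_pM2l.
rewrite (le_trans (ler_wpM2l (ltW C0) r1))//.
apply: le_trans (ler_wpM2r (normr_ge0 _) e1E).
by rewrite [leLHS]mulrA -[leRHS]mulrA ler_wpM2l// mulr_ge0// ltW.
Unshelve. all: by end_near. Qed.

Lemma embedding_continuous (S M : manifold R) (i : S -> M) (T : topologicalType)
    (f : T -> S) (a : T) :
  embedding i -> {for a, continuous (i \o f)} -> {for a, continuous f}.
Proof.
move=> [_ _ _ topi] cif P; rewrite nbhsE => -[U [oU Ua] UP].
have [W oW UW] := topi U oU.
have : nbhs (i (f a)) W.
  by apply: open_nbhs_nbhs; split=> //; move: Ua; rewrite UW.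
move=> /cif h; near=> x; apply: UP; rewrite UW /=.
by near: x; exact: h.
Unshelve. all: by end_near. Qed.

Lemma embedding_mdifferentiable (S M : manifold R) (i : S -> M) (y : S) :
  embedding i -> mdifferentiable i y.
Proof. by move=> [si _ _ _]; exact: smooth_in_mdifferentiable si. Qed.

(** [X0] and [X] stand for one immersion written in two pairs of charts, [U] and [V] for the
    transition matrices; a right inverse is carried from one pair to the other. *)
Lemma right_inverse_conj m n (X0 X : 'M[R]_(m, n)) (L : 'M[R]_(n, m))
    (U U' : 'M[R]_n) (V V' : 'M[R]_m) :
  X0 *m U = V *m X -> U *m U' = 1%:M -> V' *m V = 1%:M -> X0 *m L = 1%:M ->
  X *m (U' *m L *m V) = 1%:M.
Proof.
move=> e1 e2 e3 e4.
have -> : X = V' *m (X0 *m U) by rewrite e1 mulmxA e3 mul1mx.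
by rewrite !mulmxA -(mulmxA (V' *m X0)) e2 mulmx1 -(mulmxA V') e4 mulmx1.
Qed.

Lemma embedding_row_free (S M : manifold R) (i : S -> M) (y : S) c d :
  embedding i -> atlas S c -> atlas M d -> chart_dom c y -> chart_dom d (i y) ->
  row_free (mderiv c d i y).
Proof.
move=> ei ac ad cy dy; have [_ _ rf _] := ei.
have di := embedding_mdifferentiable y ei.
have [L JL] := row_freeP (rf y).
pose c0 := @chart_at R S y; pose d0 := @chart_at R M (i y).
have ac0 : atlas S c0 := chart_at_atlas y.
have ad0 : atlas M d0 := chart_at_atlas (i y).
have c0y : chart_dom c0 y := chart_at_dom y.
have d0y : chart_dom d0 (i y) := chart_at_dom (i y).
have e1 : mderiv c0 d0 i y *m mderiv d0 d id (i y) = mderiv c0 c id y *m mderiv c d i y.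
  rewrite -mderiv_comp//; last exact: mdifferentiable_id.
  by rewrite -mderiv_comp//; exact: mdifferentiable_id.
have e2 : mderiv d0 d id (i y) *m mderiv d d0 id (i y) = 1%:M.
  rewrite -mderiv_comp//; try exact: mdifferentiable_id.
  exact: mderiv_id.
have e3 : mderiv c c0 id y *m mderiv c0 c id y = 1%:M.
  rewrite -mderiv_comp//; try exact: mdifferentiable_id.
  exact: mderiv_id.
apply/row_freeP; exists (mderiv d d0 id (i y) *m L *m mderiv c0 c id y).
exact: right_inverse_conj e1 e2 e3 JL.
Qed.

(** Its use is for [slice_act], whose differentiability comes from that of the ambient action
    through [slice_actE]. *)
Lemma mdifferentiable_embedding_lift (S M N : manifold R) (i : S -> M) (f : N -> S) (y : N) :
  embedding i -> mdifferentiable (i \o f) y -> mdifferentiable f y.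
Proof.
move=> ei [cif dif]; have cf := embedding_continuous ei cif; split=> //.
move=> c d ac ad cy dy.
pose e := @chart_at R M (i (f y)).
have ae : atlas M e := chart_at_atlas _.
have ey : chart_dom e (i (f y)) := chart_at_dom _.
have [_ di] := embedding_mdifferentiable (f y) ei.
have dyE : (d \o f \o cinv c) (c y) = d (f y) by rewrite /= cmapK.
apply: (@differentiable_immersion_lift _ _ _ _ (e \o i \o cinv d)).
- rewrite /prop_for /continuous_at dyE.
  exact: (cvg_comp _ _ (cvg_comp _ _ (chart_inv_cvg cy) cf) (cmap_cont dy)).
- by rewrite dyE; exact: di.
- by rewrite dyE; exact: embedding_row_free.
- have := dif c e ac ae cy ey; apply: near_differentiable.
  have := chart_inv_near cy (cf _ (chart_dom_near dy)).
  by apply: filterS => p dp /=; rewrite cmapK.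
Qed.

(** Serves the velocities of orbits inside a slice: [velocity] is a [derive1], which has its meaning
    only once derivability is known. *)
Lemma derivable_embedding_lift (S M : manifold R) (i : S -> M) (gam : R -> S) (t : R) c d :
  embedding i -> atlas S c -> atlas M d ->
  chart_dom c (gam t) -> chart_dom d (i (gam t)) ->
  {for t, continuous (i \o gam)} ->
  derivable (fun s => d (i (gam s))) t (1 : R) ->
  {for t, continuous gam} /\ derivable (fun s => c (gam s)) t (1 : R).
Proof.
move=> ei ac ad cy dy cig /derivable1_diffP dd.
have cg := embedding_continuous ei cig; split=> //; apply/derivable1_diffP.
have [_ di] := embedding_mdifferentiable (gam t) ei.
apply: (@differentiable_immersion_lift _ _ _ (fun s => c (gam s)) (d \o i \o cinv c)).
- exact: (cvg_comp _ _ cg (cmap_cont cy)).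
- exact: di.
- exact: embedding_row_free.
- move: dd; apply: near_differentiable.
  have h := cg _ (chart_dom_near cy).
  by near=> s; rewrite /= cmapK//; near: s; exact: h.
Unshelve. all: by end_near. Qed.

End Immersions.
Lemma is_derive_unique (R : realType) (V W : normedModType R) (f : V -> W) a v d1 d2 :
  is_derive a v f d1 -> is_derive a v f d2 -> d1 = d2.
Proof. by case=> _ <- [_ <-]. Qed.

Lemma is_derive_mx (R : realType) (V : normedModType R) m n (F : V -> 'M[R]_(m, n)) a v
    (D : 'M[R]_(m, n)) :
  (forall j k, is_derive a v (fun x => F x j k : R) (D j k)) -> is_derive a v F D.
Proof.
move=> dF; have dF' : derivable F a v by apply/derivable_mxP => j k; case: (dF j k).
apply: DeriveDef => //; rewrite derive_mx//; apply/matrixP => j k; rewrite mxE.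
by case: (dF j k).
Qed.

Lemma near_continuous (T U : topologicalType) (f g : T -> U) (a : T) :
  (\forall z \near a, f z = g z) -> {for a, continuous f} -> {for a, continuous g}.
Proof.
move=> fg; rewrite /prop_for /continuous_at (nbhs_singleton fg) => cf.
by apply: cvg_trans cf; apply: near_eq_cvg; exact: fg.
Qed.

Lemma is_diff_near_unique (R : realType) (V W : normedModType R) (f g df dg : V -> W) (a : V) :
  (\forall z \near a, f z = g z) -> is_diff a f df -> is_diff a g dg -> df =1 dg.
Proof. by move=> /near_is_diff fg /fg [_ <-] [_ <-]. Qed.

Lemma mulmx_row_free_eq (F : fieldType) m n k (A B : 'M[F]_(m, n)) (D : 'M[F]_(n, k)) :
  row_free D -> (forall v : 'rV_m, v *m A *m D = v *m B *m D) -> A = B.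
Proof.
move=> rf h; apply/row_matrixP => j; rewrite [LHS]rowE [RHS]rowE.
exact: (row_free_inj rf).
Qed.

Lemma mulmx_intertwine (F : pzRingType) k m n (v : 'M[F]_(k, m)) (B C : 'M[F]_m)
    (D : 'M[F]_(m, n)) (N : 'M[F]_n) :
  C *m D = D *m N -> v *m (B *m C) *m D = v *m B *m D *m N.
Proof. by move=> CD; rewrite !mulmxA -[LHS]mulmxA CD mulmxA. Qed.

(** * Velocities of curves *)

Section Velocities.
Context {R : realType}.

Lemma velocity_tcoord (N : manifold R) (gam : R -> N) (y : N) c :
  gam 0 = y -> {for (0 : R), continuous gam} ->
  derivable (fun t => chart_at y (gam t)) (0 : R) (1 : R) ->
  atlas N c -> chart_dom c y ->
  is_derive (0 : R) (1 : R) (fun t => c (gam t)) (@tcoord R N c y (velocity gam)).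
Proof.
move=> <- cg dg ac cy.
have dv : is_derive (0 : R) (1 : R) (fun t => chart_at (gam 0) (gam t)) (velocity gam).
  by apply: (DeriveDef dg); rewrite -derive1E.
have := @curve_push R N N id gam 0 (velocity gam) (chart_at (gam 0)) c cg.
by apply=> //; [exact: mdifferentiable_id|exact: chart_at_atlas|exact: chart_at_dom].
Qed.

Lemma smooth_curve_derivable (N : manifold R) (gam : R -> N) (t : R) c :
  smooth_curve gam -> atlas N c -> chart_dom c (gam t) ->
  derivable (fun s => c (gam s)) t (1 : R).
Proof.
move=> [_ sg] ac cy; apply/derivable1_diffP.
by have [h _] := sg c ac 1%N; exact: h.
Qed.

Lemma chart_line (N : manifold R) (c : chart R N (mdim N)) (y : N) (v : 'rV[R]_(mdim N)) :
  chart_dom c y ->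
  exists gam : R -> N, [/\ gam 0 = y, {for (0 : R), continuous gam} &
      is_derive (0 : R) (1 : R) (fun t => c (gam t)) v].
Proof.
move=> cy; pose gam := fun t : R => cinv c (c y + t *: v).
have g0 : gam 0 = y by rewrite /gam scale0r addr0 cmapK.
have dl := is_derive_line (c y) v 0.
have cl : {for (0 : R), continuous (fun t : R => c y + t *: v)}.
  by apply: differentiable_continuous; apply/derivable1_diffP; case: dl.
rewrite /prop_for /continuous_at scale0r addr0 in cl.
exists gam; split=> //.
- by rewrite /prop_for /continuous_at g0; exact: (cvg_comp _ _ cl (chart_inv_cvg cy)).
- apply: near_eq_is_derive dl.
  have h := cl _ (chart_invK_near cy).
  near=> t; have [_ ->//] : chart_dom c (cinv c (c y + t *: v)) /\
    c (cinv c (c y + t *: v)) = c y + t *: v by near: t; exact: h.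
Unshelve. all: by end_near. Qed.

End Velocities.

(** * The exponential map and fundamental vector fields *)

Section Exponential.
Context {R : realType} {G : lie_group R} (expG : exponential G).

Lemma lg_idem (a : G) : lg_mul a a = a -> a = lg_one G.
Proof.
move=> aa; have := lg_mulV a; rewrite -{2}aa lg_mulA lg_mulV lg_mul1.
by [].
Qed.

Lemma exp0 (xi : Lie G) : expG (0 *: xi) = lg_one G.
Proof. by apply: lg_idem; rewrite -exp_add addr0. Qed.

Lemma exp_continuous (xi : Lie G) (t : R) : {for t, continuous (fun s : R => expG (s *: xi))}.
Proof. by have [h _] := exp_smooth expG xi; exact: h. Qed.

Lemma exp_derive (xi : Lie G) :
  is_derive (0 : R) (1 : R) (fun t => chart_at (lg_one G) (expG (t *: xi))) xi.
Proof.
have dom1 : chart_dom (chart_at (lg_one G)) (expG (0 *: xi)).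
  by rewrite exp0; exact: chart_at_dom.
have := smooth_curve_derivable (exp_smooth expG xi) (chart_at_atlas _) dom1.
move=> d; apply: DeriveDef => //.
have := exp_velocity expG xi; rewrite /velocity exp0 derive1E.
by [].
Qed.

Context {M : manifold R} (A : smooth_action G M).
Let cG := chart_at (lg_one G).

Lemma exp_act_derive (xi : Lie G) (y : M) d e :
  atlas M d -> atlas M e -> chart_dom d y -> chart_dom e y ->
  is_derive (0 : R) (1 : R) (fun t => e (A (expG (t *: xi)) y))
    ('d (local2 A cG d e) (cG (lg_one G), d y) (xi, 0)).
Proof.
move=> ad ae dy ey; rewrite -(exp0 xi).
have dom1 : chart_dom cG (expG (0 *: xi)) by rewrite exp0; exact: chart_at_dom.
apply: (@is_derive_local2 _ _ _ _ _ (act_smooth A) cG d e (chart_at_atlas _) ad ae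
  (fun t => expG (t *: xi)) (fun=> y) 0 xi 0) => //.
- exact: exp_continuous.
- exact: cst_continuous.
- by rewrite exp0 act1.
- exact: exp_derive.
- exact: is_derive_cst.
Qed.

Lemma exp_act_continuous (xi : Lie G) (y : M) (t : R) :
  {for t, continuous (fun s : R => A (expG (s *: xi)) y)}.
Proof.
apply: (cvg_act2 (act_smooth A)) => //; first exact: exp_continuous.
exact: cvg_cst.
Qed.

(** In this form a fundamental field is a first partial derivative of the action, so that its
    linearization becomes a mixed second derivative. *)
Lemma fundamental_tcoord (xi : Lie G) (y : M) d e :
  atlas M d -> atlas M e -> chart_dom d y -> chart_dom e y ->
  tcoord e (fundamental expG A xi y) =
    'd (local2 A cG d e) (cG (lg_one G), d y) (xi, 0).
Proof.
move=> ad ae dy ey.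
have [_ <-] := exp_act_derive xi ad ae dy ey.
have [] := @velocity_tcoord R M (fun t => A (expG (t *: xi)) y) y e; first by rewrite exp0 act1.
- exact: exp_act_continuous.
- by have [] := exp_act_derive xi (chart_at_atlas y)
    (chart_at_atlas y) (chart_at_dom y) (chart_at_dom y).
- by [].
- by [].
by move=> _ ->.
Qed.

End Exponential.
(** * Slices *)

Section SliceGeometry.
Context {R : realType} {G : lie_group R} (expG : exponential G).
Context {M : manifold R} (A : smooth_action G M) (x : M) (S : slice A x).
Let H := stabilizer A x.
Let i : S -> M := slice_incl S.
Let s : S := slice_pt S.
Let act := slice_act S.
Let cG := chart_at (lg_one G).
Let cM := @chart_at R M (i s).
Let cS := @chart_at R S s.
Let ei : embedding i := slice_incl_embedding S.
Let cG1 : chart_dom cG (lg_one G) := chart_at_dom _.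
Let cMs : chart_dom cM (i s) := chart_at_dom _.
Let cSs : chart_dom cS s := chart_at_dom _.
Let acG : atlas G cG := chart_at_atlas _.
Let acM : atlas M cM := chart_at_atlas _.
Let acS : atlas S cS := chart_at_atlas _.
Let i_diff y : mdifferentiable i y := embedding_mdifferentiable y ei.
Let isx : i s = x := slice_incl_pt S.

Local Notation Di := (mderiv cS cM i s).
Local Notation hatA := (local2 A cG cM cM).

Lemma stabilizer1 : H (lg_one G).
Proof. exact: act1. Qed.

Lemma slice_act_pt h : H h -> act h s = s.
Proof.
move=> Hh; have [_ inji _ _] := ei; apply: inji.
by rewrite /i slice_actE// -/i isx.
Qed.

Lemma slice_act1 y : act (lg_one G) y = y.
Proof.
have [_ inji _ _] := ei; apply: inji.
by rewrite /i slice_actE ?act1//; exact: stabilizer1.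
Qed.

Lemma slice_actM h k y : H h -> H k -> act (lg_mul h k) y = act h (act k y).
Proof.
move=> Hh Hk; have [_ inji _ _] := ei; apply: inji.
by rewrite /i !slice_actE// ?actM// /stabilizer /= actM Hk Hh.
Qed.

Lemma slice_base_mem : dom2 A cG cM cM (cG (lg_one G), cM (i s)).
Proof. by apply: dom2_mem => //; rewrite act1. Qed.

(* (a, v) is tangent to the fibre of (g, y) |-> g . y through (1, s), which is
   H x {s}, so its component along the slice vanishes. *)
Lemma slice_transversal (a : Lie G) (v : tangent s) :
  'd hatA (cG (lg_one G), cM (i s)) (a, v *m Di) = 0 -> v = 0.
Proof.
move=> kerA.
have [Q [p [F [F' [[sp surjQ subm fib] Fp [[_ oV _ sF'] [_ _ F'F _]]]]]]] := slice_diffeo S.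
pose q0 := p (lg_one G) s.
pose cQ := @chart_at R Q q0.
have acQ : atlas Q cQ := chart_at_atlas _.
have cQ0 : chart_dom cQ q0 := chart_at_dom _.
pose a0 := (cG (lg_one G), cS s).
(* [F'] is smooth and [F' (A g (i y)) = p g y], so the derivative of [p] along a curve with velocity
   [(a, v)] is the image under the differential of [F'] of the derivative of the action, which is
   zero. *)
have kerp : 'd (local2 p cG cS cQ) a0 (a, v) = 0.
  have [gam [g0 gc gd]] := chart_line a cG1.
  have [bet [b0 bc bd]] := chart_line v cSs.
  have ibc : {for (0 : R), continuous (i \o bet)}.
    by apply: continuous_comp => //; have [] := i_diff (bet 0).
  have ibd : is_derive (0 : R) (1 : R) (fun t => cM (i (bet t))) (v *m Di).
    have := @curve_push R S M i bet 0 v cS cM bc.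
    by rewrite b0; apply.
  have pd : is_derive (0 : R) (1 : R) (fun t => cQ (p (gam t) (bet t)))
      ('d (local2 p cG cS cQ) a0 (a, v)).
    have := @is_derive_local2 _ _ _ _ _ sp cG cS cQ acG acS acQ gam bet 0 a v gc bc.
    by rewrite g0 b0; apply.
  have Ad : is_derive (0 : R) (1 : R) (fun t => cM (A (gam t) (i (bet t)))) 0.
    have := @is_derive_local2 _ _ _ _ _ (act_smooth A) cG cM cM acG acM acM
      gam (i \o bet) 0 a (v *m Di) gc ibc.
    rewrite /= g0 b0 act1 kerA; exact.
  have Ac : {for (0 : R), continuous (fun t => A (gam t) (i (bet t)))}.
    exact: (cvg_act2 (act_smooth A)).
  have F'p t : F' (A (gam t) (i (bet t))) = p (gam t) (bet t).
    by rewrite /i -Fp F'F.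
  have F'd : mdifferentiable F' (A (gam 0) (i (bet 0))).
    apply: smooth_in_mdifferentiable sF'.
    by exists (gam 0), (bet 0).
  have := @curve_push R M Q F' (fun t => A (gam t) (i (bet t))) 0 0 cM cQ Ac F'd acM acQ.
  rewrite mul0mx F'p g0 b0 act1 => /(_ cMs cQ0 Ad).
  rewrite (_ : (fun _ => _) = (fun t => cQ (p (gam t) (bet t)))).
    by case: pd => _ <- [_ <-].
  by apply/funext => t; rewrite F'p.
have dp : dom2 p cG cS cQ a0 by apply: dom2_mem.
have C1 := smooth_local2 sp acG acS acQ 1%N.
have surj y : exists w, 'd (local2 p cG cS cQ) a0 w = y by exact: subm.
apply/eqP; rewrite -normr_le0; apply/ler_addgt0Pr => e e0; rewrite add0r.
have fibre := submersion_fibre_tangent (@dom2_open R G S Q p sp cG cS cQ) dp C1 surj kerp e0.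
have : \forall t \near (0 : R)^', `|v| <= e.
  near=> t; have t0 : t != 0 by near: t; exact: nbhs_dnbhs_neq.
  have [u [du pu] ue] : exists2 u, dom2 p cG cS cQ u /\
      local2 p cG cS cQ u = local2 p cG cS cQ a0 & `|u - (a0 + t *: (a, v))| <= e * `|t|.
    by near: t; exact: cvg_within.
  move: du pu ue => [[g y] /= [cg cy cpy] <-].
  rewrite /local2 /= !cmapK// => pgy.
  have {}pgy : p (lg_one G) s = p g y.
    by rewrite -(cmapK cpy) pgy cmapK.
  (* A point of the fibre has second component [h . s = s]. Being within [e |t|] of
     [(1, s) + t (a, v)] in charts then forces [|t v| <= e |t|]. *)
  have [h Hh [_ ->]] := (fib _ _ _ _).1 pgy.
  have -> : slice_act S h s = s by exact: slice_act_pt.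
  move=> ue.
  have : `|t *: v| <= e * `|t|.
    apply: le_trans ue; rewrite prod_normE /= le_max; apply/orP; right.
    by rewrite opprD addrA subrr add0r normrN.
  by rewrite normrZ mulrC ler_pM2r// normr_gt0.
exact: filter_const.
Unshelve. all: by end_near. Qed.

(** At a relative equilibrium [X] is the value of the fundamental field of some [eta]; subtracting
    it from the decomposition with [xi] puts [(xi - eta, XS s)] in the kernel considered in
    [slice_transversal]. *)
Lemma slice_component_zero (m : {vspace Lie G}) (X : vfield M) (XS : vfield S) :
  relative_equilibrium expG A X x -> slice_component expG m X XS ->
  XS s = 0.
Proof.
move=> req /(_ s)[xi _]; rewrite -/i => E.
have [eta Xe] : exists eta, X (i s) = fundamental expG A eta (i s) by rewrite isx.
apply: (@slice_transversal (xi - eta)); rewrite Xe in E.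
have := congr1 (@tcoord R M cM (i s)) E.
rewrite (@tcoordD _ M cM (i s)) (tcoord_differential _ (i_diff s) acS acM cSs cMs).
rewrite !(fundamental_tcoord _ _ _ acM acM cMs cMs) -/cG tcoord_chart_at => h.
have -> : (xi - eta, XS s *m Di) = (xi, 0) - (eta, 0) + (0, XS s *m Di).
  by congr (_, _); rewrite /= ?subr0 ?addr0 ?add0r.
rewrite linearD linearB /= h -(mderiv_partial2 (act_smooth A) acG acM acM)// ?act1//.
have -> : A (lg_one G) = id by apply/funext => y; rewrite act1.
by rewrite mderiv_id// mulmx1 addrC addrA subrr.
Qed.

Lemma stabilizer_act_mdifferentiable h y : H h -> mdifferentiable (act h) y.
Proof.
move=> Hh; apply: (mdifferentiable_embedding_lift ei).
have -> : i \o act h = A h \o i by apply/funext => z; rewrite /i /= slice_actE.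
apply: mdifferentiable_comp => //; exact: (mdifferentiable_partial2 (act_smooth A)).
Qed.

(** * The slice representation *)

Lemma slice_repE h : H h -> slice_rep S h = mderiv cS cS (act h) s.
Proof.
by move=> Hh; rewrite /slice_rep differentialE -/act -/s slice_act_pt.
Qed.

Let As h : H h -> A h (i s) = i s.
Proof. by rewrite isx. Qed.

(** This is the derivative of [i \o act h = A h \o i] at the fixed point [s]. As [Di] has full row
    rank, it determines [slice_rep] from the ambient action. *)
Lemma slice_rep_intertwine h : H h ->
  slice_rep S h *m Di = Di *m mderiv cM cM (A h) (i s).
Proof.
move=> Hh; rewrite slice_repE//.
have d1 := stabilizer_act_mdifferentiable s Hh.
have d2 := mdifferentiable_partial2 (act_smooth A) h (i s).
have L : mderiv cS cM (i \o act h) s =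
    mderiv cS cS (act h) s *m mderiv cS cM i (act h s).
  by apply: mderiv_comp => //; rewrite slice_act_pt.
have E : mderiv cS cM (A h \o i) s = Di *m mderiv cM cM (A h) (i s).
  by apply: mderiv_comp => //; rewrite As.
rewrite slice_act_pt// in L; rewrite -L -E; congr (mderiv cS cM _ s).
by apply/funext => z; rewrite /i /= slice_actE.
Qed.
(** Joint continuity in the group element and the point serves twice: with the point fixed it bounds
    the representation on the compact stabilizer, and with [h] fixed it supplies the continuous
    factor when the invariance of a field is differentiated. *)
Lemma partial_act_continuous h : H h ->
  {for (h, i s), continuous (fun q : G * M => mderiv cM cM (A q.1) q.2)}.
Proof.
move=> Hh; pose c0 := @chart_at R G h.
have ac0 : atlas G c0 := chart_at_atlas h.
have c0h : chart_dom c0 h := chart_at_dom h.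
have dm : dom2 A c0 cM cM (c0 h, cM (i s)) by apply: dom2_mem; rewrite ?As.
apply: cvg_mx_coord => j k.
have [_ /(_ (0, delta_mx 0 j)) cd] := smooth_local2 (act_smooth A) ac0 acM acM 1%N.
have c1 : (c0 q.1, cM q.2) @[q --> (h, i s)] --> (c0 h, cM (i s)).
  have k1 : c0 q.1 @[q --> (h, i s)] --> c0 h.
    apply: (@cvg_comp _ _ _ fst c0 _ (nbhs h)); first exact: cvg_fst.
    exact: (cmap_cont c0h).
  have k2 : cM q.2 @[q --> (h, i s)] --> cM (i s).
    apply: (@cvg_comp _ _ _ snd cM _ (nbhs (i s))); first exact: cvg_snd.
    exact: (cmap_cont cMs).
  exact: (cvg_pair k1 k2).
have c2 := cvg_comp _ _ c1 (cd _ dm).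
have c3 := cvg_comp _ _ c2 (@coord_continuous _ _ _ 0 k _).
have eqn (q : G * M) : chart_dom c0 q.1 -> chart_dom cM q.2 -> chart_dom cM (A q.1 q.2) ->
    'd (local2 A c0 cM cM) (c0 q.1, cM q.2) (0, delta_mx 0 j) 0 k =
    mderiv cM cM (A q.1) q.2 j k.
  move=> q1 q2 q3; rewrite -(mderiv_partial2 (act_smooth A) ac0 acM acM)//.
  by rewrite -rowE mxE.
have [cA _] := act_smooth A.
have n3 := cA (h, i s); rewrite /continuous_at /= As// in n3.
apply: (near_continuous _ c3).
near=> q; apply: eqn; near: q.
- exact: (cvg_fst (chart_dom_near c0h)).
- exact: (cvg_snd (chart_dom_near cMs)).
- exact: (n3 _ (chart_dom_near cMs)).
Unshelve. all: by end_near. Qed.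

Lemma stabilizer_compact : proper_action A -> compact H.
Proof.
have c1 : compact [set (x, x) : M * M] by exact: compact_set1.
move=> /(_ _ c1) cK.
have -> : H = fst @` ((fun p : G * M => (A p.1 p.2, p.2)) @^-1` [set (x, x)]).
  apply/seteqP; split=> [h Hh|_ [[h y] /= [Ay yx] <-]].
    by exists (h, x) => //=; rewrite Hh.
  by rewrite /H /stabilizer /= -{1}yx.
apply: continuous_compact cK; apply: continuous_subspaceT => q.
exact: cvg_fst.
Qed.

(** Continuity in [h] is available for the ambient action: [slice_rep S h] is [Di *m N h *m R0] with
    [R0] a right inverse of [Di] and [N] continuous on the compact stabilizer. *)
Lemma slice_rep_bounded : proper_action A ->
  exists C : R, forall h, H h -> `|slice_rep S h| <= C.
Proof.
move=> /stabilizer_compact cH.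
have [R0 DR0] : exists L, Di *m L = 1%:M by apply/row_freeP; exact: embedding_row_free.
pose N h := mderiv cM cM (A h) (i s).
have cN : {within H, continuous N}.
  apply: continuous_in_subspaceT => h /set_mem Hh.
  apply: (@cvg_comp _ _ _ (fun k => (k, i s))
    (fun q : G * M => mderiv cM cM (A q.1) q.2) _ (nbhs (h, i s))).
    exact: (cvg_pair cvg_id (cvg_cst _)).
  exact: partial_act_continuous.
have /compact_bounded [C [_ hC]] := continuous_compact cN cH.
have NC h : H h -> `|N h| <= C + 1.
  by move=> Hh; apply: (hC (C + 1)); rewrite ?ltrDl//; exists h.
exists ((mdim M)%:R * ((mdim M)%:R * (`|Di| * (C + 1)) * `|R0|)) => h Hh.
have -> : slice_rep S h = Di *m N h *m R0.
  by rewrite -slice_rep_intertwine// -mulmxA DR0 mulmx1.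
apply: le_trans (norm_mulmx_le _ _) _; rewrite ler_wpM2l// ler_wpM2r//.
apply: le_trans (norm_mulmx_le _ _) _; rewrite ler_wpM2l// ler_wpM2l//.
exact: NC.
Qed.

Lemma slice_rep1 : slice_rep S (lg_one G) = 1%:M.
Proof.
rewrite slice_repE; last exact: stabilizer1.
have -> : act (lg_one G) = id by apply/funext => y; exact: slice_act1.
exact: mderiv_id.
Qed.

Lemma slice_repM h k : H h -> H k ->
  slice_rep S (lg_mul h k) = slice_rep S k *m slice_rep S h.
Proof.
move=> Hh Hk; have Hhk : H (lg_mul h k) by rewrite /H /stabilizer /= actM Hk Hh.
rewrite !slice_repE//.
have dk := stabilizer_act_mdifferentiable s Hk.
have dh := stabilizer_act_mdifferentiable (act k s) Hh.
have L : mderiv cS cS (act h \o act k) s =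
    mderiv cS cS (act k) s *m mderiv cS cS (act h) (act k s).
  by apply: mderiv_comp => //; rewrite (slice_act_pt Hk)// (slice_act_pt Hh).
rewrite (slice_act_pt Hk) in L.
have E : act (lg_mul h k) = act h \o act k.
  by apply/funext => y; exact: slice_actM.
by rewrite E; exact: L.
Qed.

Lemma local_act_Cr k : Cr k (dom2 A cG cM cM) hatA.
Proof. exact: (smooth_local2 (act_smooth A)). Qed.

Let base := (cG (lg_one G), cM (i s)).

(** [slice_rep] differentiates the action in the point first and the left-hand side then
    differentiates in the group. [schwarz_rV] exchanges the two orders, which expresses [K] through
    the linearization of the fundamental field of [xi]. *)
Lemma slice_rep_derive (xi : Lie G) : sub_lie expG H xi ->
  exists2 K, is_derive (0 : R) (1 : R) (fun t => slice_rep S (expG (t *: xi))) K &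
    forall v, v *m K *m Di = 'd (fun q => 'd hatA q (xi, 0)) base (0, v *m Di).
Proof.
move=> Hxi.
have [R0 DR0] : exists L, Di *m L = 1%:M by apply/row_freeP; exact: embedding_row_free.
pose N t := mderiv cM cM (A (expG (t *: xi))) (i s).
pose B u := 'd (fun q => 'd hatA q (xi, 0)) base (0, u).
have schw u : 'd (fun q => 'd hatA q (0, u)) base (xi, 0) = B u.
  apply: (schwarz_rV _ _ _ slice_base_mem (local_act_Cr 2)).
  exact: (dom2_open (act_smooth A)).
have dcurve : is_derive (0 : R) (1 : R)
    (fun t => (cG (expG (t *: xi)), cM (i s))) (xi, 0).
  have [/derivable1_diffP dg gx] := exp_derive expG xi.
  have dp := differentiable_pair dg (differentiable_cst (cM (i s)) (0 : R)).
  apply: DeriveDef; first exact/derivable1_diffP.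
  by rewrite deriveE// diff_pair//= -(deriveE _ dg) gx diff_val.
have NB u : is_derive (0 : R) (1 : R) (fun t => u *m N t) (B u).
  have dgu : differentiable (fun q => 'd hatA q (0, u))
      ((fun t => (cG (expG (t *: xi)), cM (i s))) (0 : R)).
    rewrite /= exp0; have [_ /(_ (0, u)) [h _]] := local_act_Cr 2.
    apply: h; exact: slice_base_mem.
  have := is_derive_diff_comp dgu dcurve; rewrite /= exp0.
  rewrite -schw; apply: near_eq_is_derive.
  have ce := @exp_continuous R G expG xi 0; rewrite /prop_for /continuous_at exp0 in ce.
  have h1 := ce _ (chart_dom_near cG1).
  near=> t; rewrite /= -(mderiv_partial2 (act_smooth A) acG acM acM)//.
    by near: t; exact: h1.
  by rewrite As//; exact: Hxi.
pose Gam := \matrix_(a, b) (B (delta_mx 0 a)) 0 b.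
have NG : is_derive (0 : R) (1 : R) N Gam.
  apply: is_derive_mx => a b; rewrite mxE.
  have lc : linear (fun M0 : 'rV[R]_(mdim M) => M0 0 b : R) by move=> k u v; rewrite !mxE.
  have := is_derive_linear lc (NB (delta_mx 0 a)).
  by congr is_derive; apply/funext => t; rewrite -rowE mxE.
have linJ : linear (fun N0 => Di *m N0 *m R0).
  by move=> k u v; rewrite mulmxDr mulmxDl -scalemxAr -scalemxAl.
have JE t : slice_rep S (expG (t *: xi)) = Di *m N t *m R0.
  by rewrite -slice_rep_intertwine; [rewrite -mulmxA DR0 mulmx1|exact: Hxi].
have dJ : is_derive (0 : R) (1 : R) (fun t => slice_rep S (expG (t *: xi))) (Di *m Gam *m R0).
  have := is_derive_linear linJ NG.
  by congr is_derive; apply/funext => t; rewrite JE.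
exists (Di *m Gam *m R0) => // v.
have lin1 : linear (fun K : 'M[R]_(mdim S) => v *m K *m Di).
  by move=> k u w; rewrite mulmxDr mulmxDl -scalemxAr -scalemxAl.
apply: is_derive_unique (is_derive_linear lin1 dJ) _.
have := NB (v *m Di); congr is_derive; apply/funext => t.
by rewrite -[RHS]mulmxA slice_rep_intertwine ?mulmxA//; exact: Hxi.
Unshelve. all: by end_near. Qed.

Lemma local_act_stabilizer (xi : Lie G) : sub_lie expG H xi -> 'd hatA base (xi, 0) = 0.
Proof.
move=> Hxi; apply: is_derive_unique (exp_act_derive expG A xi acM acM cMs cMs) _.
rewrite (_ : (fun _ => _) = cst (cM (i s))); first exact: is_derive_cst.
by apply/funext => t /=; rewrite As//; exact: Hxi.
Qed.

Lemma slice_fundamental (xi : Lie G) y c e : sub_lie expG H xi ->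
  atlas S c -> atlas M e -> chart_dom c y -> chart_dom e (i y) ->
  tcoord c (fundamental expG act xi y) *m mderiv c e i y =
  'd (local2 A cG e e) (cG (lg_one G), e (i y)) (xi, 0).
Proof.
move=> Hxi ac ae cy ey.
pose gam t := act (expG (t *: xi)) y.
have g0 : gam 0 = y by rewrite /gam exp0 slice_act1.
have iE : i \o gam = (fun t => A (expG (t *: xi)) (i y)).
  by apply/funext => t; rewrite /gam /i /= slice_actE//; exact: Hxi.
have iE' t : A (expG (t *: xi)) (i y) = i (gam t).
  by rewrite /gam /i slice_actE//; exact: Hxi.
have dA := exp_act_derive expG A xi ae ae ey ey.
have eE : (fun t : R => e (A (expG (t *: xi)) (i y))) = (fun t => e (i (gam t))).
  by apply/funext => t; rewrite iE'.
rewrite eE in dA.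
have [cg dg] : {for (0 : R), continuous gam} /\
    derivable (fun t => chart_at y (gam t)) (0 : R) (1 : R).
  apply: (@derivable_embedding_lift R S M i gam 0 (chart_at y) e ei); rewrite ?g0//.
  - exact: chart_at_atlas.
  - exact: chart_at_dom.
  - by rewrite iE; exact: exp_act_continuous.
have dt := velocity_tcoord g0 cg dg ac cy.
have := @curve_push R S M i gam 0 _ c e cg; rewrite g0 => /(_ _ (i_diff y) ac ae cy ey dt) dc.
exact: is_derive_unique dc dA.
Qed.

(** * Linearizations at the base point of a slice *)

Let iota := cM \o i \o cinv cS.
Let p0 := cS s.

Lemma incl_jacobian_continuous : {for p0, continuous (jacobian iota)}.
Proof.
have [si _ _ _] := ei; have [_ sic] := si.
apply: (continuous_jacobian (sic cS cM acS acM 1%N)).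
by exists s => //; split.
Qed.

Lemma incl_local_base : iota p0 = cM (i s).
Proof. by rewrite /iota /p0 /= cmapK. Qed.

(** [W] is [psi_S] in the chart. After composition with the embedding, [psi] is split as [psi s]
    plus the increment [g]: the constant part gives the right-hand side, and the part linear in [g]
    has zero derivative. *)
Lemma slice_fundamental_linearization (U : set S) (psi : S -> Lie G)
    (W : 'rV[R]_(mdim S) -> 'rV[R]_(mdim S)) :
  open U -> U s -> (forall y, U y -> sub_lie expG H (psi y)) ->
  differentiable (psi \o cinv cS) p0 ->
  differentiable W p0 ->
  (\forall p \near p0, W p = @tcoord R S cS (cinv cS p)
       (fundamental expG act (psi (cinv cS p)) (cinv cS p))) ->
  forall v, v *m jacobian W p0 *m Di =
    'd (fun q => 'd hatA q (psi s, 0)) base (0, v *m Di).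
Proof.
move=> oU Us Hpsi dpsi dW WE.
have Upsi : \forall p \near p0, sub_lie expG H (psi (cinv cS p)).
  apply: (chart_inv_near (P := [set y | sub_lie expG H (psi y)]) cSs).
  near=> y; apply: Hpsi.
  by near: y; exact: open_nbhs_nbhs.
have W0 : W p0 = 0.
  rewrite (nbhs_singleton WE) cmapK//.
  have := slice_fundamental (Hpsi _ Us) acS acM cSs cMs.
  rewrite (local_act_stabilizer (Hpsi _ Us)) => h.
  have rf : row_free Di by exact: embedding_row_free.
  by apply: (row_free_inj rf); rewrite mul0mx; exact: h.
have dWB := is_diff_mulmx0 dW W0 incl_jacobian_continuous.
pose kap p := (cG (lg_one G), iota p).
have diota : differentiable iota p0 by have [_ h] := i_diff s; exact: h.
have kap0 : kap p0 = base by rewrite /kap incl_local_base.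
have dkap : is_diff p0 kap (fun v => (0, v *m Di)).
  have dp := differentiable_pair (differentiable_cst (cG (lg_one G)) p0) diota.
  apply: DiffDef => //; rewrite diff_pair//; apply/funext => v /=.
  by rewrite diff_val -jacobianE.
pose f q := 'd hatA q (psi s, 0).
have df : differentiable f (kap p0).
  rewrite kap0; have [_ /(_ (psi s, 0)) [h _]] := local_act_Cr 2.
  by apply: h; exact: slice_base_mem.
have dS1 : is_diff p0 (f \o kap) (fun v => 'd f base (0, v *m Di)).
  have [dk kE] := dkap; apply: DiffDef; first exact: differentiable_comp.
  by rewrite diff_comp// kE kap0.
(* The matrix of the linear map sending [xi] to its fundamental vector at [q]; it turns the
   dependence on [g] into a product to which [is_diff_mulmx0] applies. *)
pose Lam q := \matrix_(a, b) ('d hatA q (delta_mx 0 a, 0) 0 b) : 'M[R]_(mdim G, mdim M).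
have LamE q xi : 'd hatA q (xi, 0) = xi *m Lam q.
  rewrite {1}[xi]row_sum_delta.
  have -> : (\sum_j xi 0 j *: delta_mx 0 j, 0) =
      \sum_j xi 0 j *: (delta_mx 0 j, 0) :> 'rV[R]_(mdim G) * 'rV[R]_(mdim M).
    rewrite [RHS]surjective_pairing; congr (_, _).
      by rewrite raddf_sum.
    by rewrite raddf_sum big1//= => j _; rewrite scaler0.
  rewrite linear_sum; apply/rowP => b; rewrite summxE mxE; apply: eq_bigr => j _.
  by rewrite linearZ !mxE.
have cLam : {for p0, continuous (Lam \o kap)}.
  apply: cvg_mx_coord => a b.
  have [_ /(_ (delta_mx 0 a, 0)) c1] := local_act_Cr 1.
  have ck : {for p0, continuous kap} by apply: differentiable_continuous; case: dkap.
  have dk : dom2 A cG cM cM (kap p0) by rewrite kap0; exact: slice_base_mem.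
  have c2 := cvg_comp _ _ ck (c1 _ dk).
  have c3 := cvg_comp _ _ c2 (@coord_continuous _ _ _ 0 b _).
  by apply: (near_continuous _ c3); near=> p; rewrite /= mxE.
pose g p := psi (cinv cS p) - psi s.
have dg : differentiable g p0.
  by have [] := is_diffB (differentiableP dpsi) (is_diff_cst (psi s) p0).
have g0 : g p0 = 0 by rewrite /g cmapK// subrr.
have dS2 := is_diff_mulmx0 dg g0 cLam.
have cL : {for p0, continuous (fun=> Lam base)} by exact: cst_continuous.
(* Near [p0] both values of [psi] entering [g] lie in the Lie algebra of the stabilizer, so their
   fundamental vectors vanish at the base point. Hence [g p *m Lam base] is locally zero, and so is
   its derivative. *)
have dg0 v : 'd g p0 v *m Lam base = 0.
  have n0 : \forall p \near p0, g p *m Lam base = (cst 0 : _ -> 'rV[R]_(mdim M)) p.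
    near=> p; rewrite /g mulmxBl -!LamE !local_act_stabilizer ?subrr//; first exact: Hpsi.
    by near: p; exact: Upsi.
  exact: (is_diff_near_unique n0 (is_diff_mulmx0 dg g0 cL) (is_diff_cst 0 p0) v).
have sum_near : \forall p \near p0, W p *m jacobian iota p = f (kap p) + g p *m Lam (kap p).
  near=> p; rewrite -LamE -linearD /=.
  have -> : (psi s, 0) + (g p, 0) = (psi (cinv cS p), 0) :> 'rV[R]_(mdim G) * 'rV[R]_(mdim M).
    by congr (_, _); rewrite /= ?addr0// addrC subrK.
  have [cp cK] : chart_dom cS (cinv cS p) /\ cS (cinv cS p) = p.
    by near: p; exact: chart_invK_near.
  have Mp : chart_dom cM (i (cinv cS p)).
    near: p; apply: (chart_inv_near (P := i @^-1` chart_dom cM) cSs).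
    have [ci _] := i_diff s; exact: (ci _ (chart_dom_near cMs)).
  have Hp : sub_lie expG H (psi (cinv cS p)) by near: p; exact: Upsi.
  have := slice_fundamental Hp acS acM cp Mp.
  rewrite /mderiv cK /kap /iota /= => <-.
  by congr (_ *m _); near: p.
move=> v.
have := is_diff_near_unique sum_near dWB (is_diffD dS1 dS2) v.
rewrite -[(_ + _) v]/(_ + _) -jacobianE => E.
apply: (etrans E); rewrite -[RHS]addr0; congr (_ + _).
by rewrite /= kap0; exact: dg0.
Unshelve. all: by end_near. Qed.

(** The invariance identity is differentiated after composition with the embedding, which replaces
    the derivative of [act h] by that of [A h], continuous in the point by [partial_act_continuous].
    As the field vanishes at [s], the matrix factors enter only through their values there, and [Di]
    is cancelled at the end. *)
Lemma linearization_slice_rep (XS : vfield S) h :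
  smooth_vfield XS -> invariant_vfield H act XS -> XS s = 0 -> H h ->
  linearization XS s *m slice_rep S h = slice_rep S h *m linearization XS s.
Proof.
move=> sX invX X0 Hh.
pose V := vfield_in_chart XS cS.
have dV : differentiable V p0.
  by have [h0 _] := sX cS acS 1%N; apply: h0; exists s.
have V0 : V p0 = 0.
  rewrite /V /vfield_in_chart /p0 cmapK// X0; exact: mul0mx.
pose ah := cS \o act h \o cinv cS.
have dah_m := stabilizer_act_mdifferentiable s Hh.
have ah0 : ah p0 = p0 by rewrite /ah /p0 /= cmapK// slice_act_pt.
have dah : differentiable ah p0 by have [_ h0] := dah_m; apply: h0; rewrite ?slice_act_pt.
have dV' : differentiable V (ah p0) by rewrite ah0.
have dVah : differentiable (V \o ah) p0 by apply: differentiable_comp; rewrite ?ah0.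
have Vah0 : (V \o ah) p0 = 0 by rewrite /= ah0.
have cJ := incl_jacobian_continuous.
have cah : {for p0, continuous ah} by exact: differentiable_continuous.
have cJah : {for p0, continuous (jacobian iota \o ah)}.
  by apply: continuous_comp; rewrite ?ah0.
pose NN p := mderiv cM cM (A h) (i (cinv cS p)).
have cNN : {for p0, continuous NN}.
  have c1 : i (cinv cS p) @[p --> p0] --> i s.
    by have [ci _] := i_diff s; exact: (cvg_comp _ _ (chart_inv_cvg cSs) ci).
  have c2 : (h, i (cinv cS p)) @[p --> p0] --> (h, i s).
    exact: (cvg_pair (cvg_cst h) c1).
  have := cvg_comp _ _ c2 (partial_act_continuous Hh).
  by rewrite /prop_for /continuous_at /NN /p0 cmapK.
have NN0 : NN p0 = mderiv cM cM (A h) (i s) by rewrite /NN /p0 cmapK.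
have E : \forall p \near p0, (V \o ah) p *m jacobian iota (ah p) = V p *m jacobian iota p *m NN p.
  near=> p.
  have [cp cK] : chart_dom cS (cinv cS p) /\ cS (cinv cS p) = p.
    by near: p; exact: chart_invK_near.
  have acp : chart_dom cS (act h (cinv cS p)).
    near: p; apply: (chart_inv_near (P := act h @^-1` chart_dom cS) cSs).
    have [ca _] := dah_m.
    have sn := chart_dom_near cSs; rewrite -{1}(slice_act_pt Hh) in sn.
    exact: (ca _ sn).
  have iap : chart_dom cM (i (act h (cinv cS p))).
    near: p; apply: (chart_inv_near (P := (i \o act h) @^-1` chart_dom cM) cSs).
    have [ca _] := mdifferentiable_comp dah_m (i_diff _).
    have sn := chart_dom_near cMs; rewrite -{1}(slice_act_pt Hh) in sn.
    exact: (ca _ sn).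
  have ip : chart_dom cM (i (cinv cS p)).
    near: p; apply: (chart_inv_near (P := i @^-1` chart_dom cM) cSs).
    have [ci _] := i_diff s; exact: (ci _ (chart_dom_near cMs)).
  set y := cinv cS p in cp cK acp iap ip *.
  have dy := stabilizer_act_mdifferentiable y Hh.
  have -> : (V \o ah) p = tcoord cS (XS (act h y)).
    by rewrite /V /ah /vfield_in_chart /= cmapK.
  have -> : jacobian iota (ah p) = mderiv cS cM i (act h y) by [].
  have -> : jacobian iota p = mderiv cS cM i y by rewrite /mderiv cK.
  have -> : tcoord cS (XS (act h y)) = tcoord cS (XS y) *m mderiv cS cS (act h) y.
    rewrite (invX h y Hh).
    exact: (tcoord_differential (XS y) dy acS acS cp acp).
  have e1 : mderiv cS cM (i \o act h) y = mderiv cS cS (act h) y *m mderiv cS cM i (act h y).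
    exact: mderiv_comp.
  have iE : i \o act h = A h \o i by apply/funext => z; rewrite /i /= slice_actE.
  have dA := mdifferentiable_partial2 (act_smooth A) h (i y).
  have Aiy : chart_dom cM (A h (i y)) by rewrite /i -(slice_actE _ Hh).
  have e2 := mderiv_comp (i_diff y) dA acS acM acM cp ip Aiy.
  rewrite -[LHS]mulmxA -e1 iE e2 [LHS]mulmxA.
  reflexivity.
have d1 := is_diff_mulmx0 dVah Vah0 cJah.
have [dF F_E] := is_diff_mulmx0 dV V0 cJ.
have F0 : V p0 *m jacobian iota p0 = 0 by rewrite V0 mul0mx.
have d2 := is_diff_mulmx0 dF F0 cNN.
have rf : row_free Di by exact: embedding_row_free.
have repE : slice_rep S h = jacobian ah p0 by rewrite slice_repE.
apply: (mulmx_row_free_eq rf) => v.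
have key := is_diff_near_unique E d1 d2 v.
have Jah0 : (jacobian iota \o ah) p0 = Di by rewrite /comp ah0.
have k1 : 'd (V \o ah) p0 v *m (jacobian iota \o ah) p0 =
    v *m (slice_rep S h *m linearization XS s) *m Di.
  rewrite repE -[jacobian ah p0 *m _]/(jacobian ah p0 *m jacobian V p0).
  have := jacobian_comp dah dV'; rewrite ah0 => <-.
  rewrite Jah0 (jacobianE (V \o ah) p0 v); reflexivity.
have k2 : 'd (fun p => V p *m jacobian iota p) p0 v *m NN p0 =
    v *m linearization XS s *m Di *m mderiv cM cM (A h) (i s).
  rewrite NN0; congr (_ *m _).
  have FEv := congr1 (fun F => F v) F_E.
  by apply: (etrans FEv); rewrite -jacobianE.
have gl := mulmx_intertwine v (linearization XS s) (slice_rep_intertwine Hh).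
exact: (etrans gl (etrans (esym k2) (etrans (esym key) k1))).
Unshelve. all: by end_near. Qed.

Lemma slice_rep_fundamental_derive (U : set S) (psi : S -> Lie G)
    (W : 'rV[R]_(mdim S) -> 'rV[R]_(mdim S)) :
  open U -> U s -> (forall y, U y -> sub_lie expG H (psi y)) ->
  differentiable (psi \o cinv cS) p0 ->
  differentiable W p0 ->
  (\forall p \near p0, W p = @tcoord R S cS (cinv cS p)
       (fundamental expG act (psi (cinv cS p)) (cinv cS p))) ->
  is_derive (0 : R) (1 : R) (fun t => slice_rep S (expG (t *: psi s))) (jacobian W p0).
Proof.
move=> oU Us Hpsi dpsi dW WE.
have [K dK KE] := slice_rep_derive (Hpsi _ Us).
have rf : row_free Di by exact: embedding_row_free.
suff -> : jacobian W p0 = K by [].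
apply: (mulmx_row_free_eq rf) => v; rewrite KE.
exact: (slice_fundamental_linearization oU Us Hpsi dpsi dW WE v).
Qed.

(** * The generator of the slice representation along a one-parameter subgroup *)

Section Generator.
Variables (xi : Lie G) (K : 'M[R]_(mdim S)).
Hypothesis Hxi : sub_lie expG H xi.
Hypothesis dK : is_derive (0 : R) (1 : R) (fun t => slice_rep S (expG (t *: xi))) K.

Lemma slice_drepN : slice_drep expG S (- xi) = - K.
Proof.
rewrite /slice_drep derive1E; pose J t := slice_rep S (expG (t *: xi)).
have [/derivable1_diffP dJ JK] := dK.
have dJ0 : differentiable J (- 0) by rewrite oppr0.
have dN := @is_derive_diff_comp _ _ _ J (fun t : R => - t) 0 (-1) dJ0 (is_deriveNid _ _).
have -> : (fun t : R => slice_rep S (expG (t *: - xi))) = J \o (fun t => - t).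
  by apply/funext => t; rewrite /J /= scalerN scaleNr.
have [_ ->] := dN.
by rewrite linearN oppr0 -(deriveE _ dJ) JK.
Qed.

Lemma slice_generator_semisimple : proper_action A -> imaginary_semisimple K.
Proof.
move=> properA; pose J t := slice_rep S (expG (t *: xi)).
have Jadd u t : J (u + t) = J u *m J t.
  (* With row vectors [slice_repM] reverses products; exchanging the two times first restores the
     order. *)
  by rewrite /J addrC exp_add slice_repM//; exact: Hxi.
have J0 : J 0 = 1%:M by rewrite /J exp0 slice_rep1.
have [C JC] := slice_rep_bounded properA.
apply: (bounded_generator_imaginary_semisimple Jadd J0 dK (C := C)) => t.
by apply: JC; exact: Hxi.
Qed.

Lemma slice_generator_comm (XS : vfield S) :
  smooth_vfield XS -> invariant_vfield H act XS -> XS s = 0 ->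
  linearization XS s *m K = K *m linearization XS s.
Proof.
move=> sX invX X0; set D := linearization XS s.
have linl : linear (fun N : 'M[R]_(mdim S) => D *m N).
  by move=> k u v; rewrite mulmxDr -scalemxAr.
have linr : linear (fun N : 'M[R]_(mdim S) => N *m D).
  by move=> k u v; rewrite mulmxDl -scalemxAl.
have dr := is_derive_linear linr dK.
have dl := is_derive_linear linl dK.
have E : (fun t : R => D *m slice_rep S (expG (t *: xi))) =
    (fun t : R => slice_rep S (expG (t *: xi)) *m D).
  apply/funext => t; exact: (linearization_slice_rep sX invX X0 (Hxi t)).
rewrite E in dl; exact: is_derive_unique dl dr.
Qed.

End Generator.

End SliceGeometry.
(** * Conclusion *)

(** A matrix commuting with [D2] and equal to its difference from [Tinv *m D1 *m T] also commutes
    with the latter. Carried over by [T] it becomes a perturbation of [D1] commuting with [D1], so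
    both directions are instances of [maps_eigenvectors_semisimple], with perturbations of opposite
    sign. *)
Lemma maps_eigenvectors_conj (R : realType) m n (D1 : 'M[R]_m) (D2 : 'M[R]_n)
    (T : 'M[R]_(m, n)) (Tinv : 'M[R]_(n, m)) (K : 'M[R]_n) :
  T *m Tinv = 1%:M -> Tinv *m T = 1%:M -> Tinv *m D1 *m T - D2 = K ->
  D2 *m K = K *m D2 -> imaginary_semisimple K ->
  maps_eigenvectors D1 T D2 /\ maps_eigenvectors D2 Tinv D1.
Proof.
move=> TT' T'T KD D2_comm_K /imaginary_semisimpleN sK.
have DK : D2 - Tinv *m D1 *m T = - K by rewrite -KD opprB.
have D2K : D2 *m - K = - K *m D2 by rewrite mulmxN mulNmx D2_comm_K.
(* From here on [K] denotes the opposite matrix, so that [D2 = Tinv *m D1 *m T + K]. *)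
move: (- K) sK DK D2K => {KD D2_comm_K}K sK DK D2K.
have D1E : Tinv *m D1 *m T = D2 - K by rewrite -DK subKr.
have TD2 : T *m D2 = D1 *m T + T *m K.
  rewrite -(subrK K D2) -D1E mulmxDr; congr (_ + _).
  by rewrite !mulmxA TT' mul1mx.
split.
  apply: (maps_eigenvectors_semisimple (K := T *m K *m Tinv) TT').
  - by rewrite TD2 mulmxDl -[T *m K *m Tinv *m T]mulmxA T'T mulmx1.
  - have D1T : D1 *m T = T *m D2 - T *m K by rewrite TD2 addrK.
    have T'D1 : Tinv *m D1 = D2 *m Tinv - K *m Tinv.
      rewrite -mulmxBl -D1E -[RHS]mulmxA TT' mulmx1.
      by [].
    rewrite !mulmxA D1T -[T *m K *m Tinv *m D1]mulmxA T'D1 mulmxBr !mulmxBl !mulmxA.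
    by rewrite -(mulmxA T D2) D2K mulmxA.
  - exact: imaginary_semisimple_conj.
apply: (maps_eigenvectors_semisimple (K := - K) T'T).
- by rewrite -D1E -[RHS]mulmxA TT' mulmx1.
- by rewrite mulmxN mulNmx D2K.
- exact: imaginary_semisimpleN.
Qed.

(** * Vector fields transported by a local diffeomorphism *)

Section Diffeomorphisms.
Context {R : realType} {M N : manifold R}.
Variables (U : set M) (V : set N) (f : M -> N) (f' : N -> M).
Hypothesis ff' : diffeo_on U V f f'.

Lemma diffeo_mderivK y c d : U y -> atlas M c -> atlas N d ->
  chart_dom c y -> chart_dom d (f y) ->
  mderiv c d f y *m mderiv d c f' (f y) = 1%:M.
Proof.
case: ff' => -[oU oV sf sf'] [fV f'U f'f _] Uy ac ad cy dy.
have df := smooth_in_mdifferentiable Uy sf.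
have df' := smooth_in_mdifferentiable (fV _ Uy) sf'.
have cy' : chart_dom c (f' (f y)) by rewrite f'f.
rewrite -(mderiv_comp df df' ac ad ac cy dy cy') -(mderiv_id cy).
apply: mderiv_near => //; last exact: mdifferentiable_comp.
by near=> z; apply: f'f; near: z; exact: open_nbhs_nbhs.
Unshelve. all: by end_near. Qed.

Lemma diffeo_mderivKV y c d : U y -> atlas M c -> atlas N d ->
  chart_dom c y -> chart_dom d (f y) ->
  mderiv d c f' (f y) *m mderiv c d f y = 1%:M.
Proof.
case: ff' => -[oU oV sf sf'] [fV f'U f'f f'K] Uy ac ad cy dy.
have df := smooth_in_mdifferentiable Uy sf.
have df' := smooth_in_mdifferentiable (fV _ Uy) sf'.
have cy' : chart_dom c (f' (f y)) by rewrite f'f.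
have dfy : mdifferentiable f (f' (f y)) by rewrite f'f.
have dy' : chart_dom d (f (f' (f y))) by rewrite f'f.
have := mderiv_comp df' dfy ad ac ad dy cy' dy'; rewrite f'f// => <-.
rewrite -(mderiv_id dy); apply: mderiv_near => //; last exact: mdifferentiable_comp.
near=> z; apply: f'K; near: z; apply: open_nbhs_nbhs; split=> //; exact: fV.
Unshelve. all: by end_near. Qed.

(** In charts the transported field is [X] along the inverse map times the Jacobian of [f]. Since
    [X] vanishes at [y], the variation of this Jacobian does not contribute, which leaves the
    conjugate of the linearization; the differentiability of the transported field is obtained at
    the same time. *)
Lemma push_vfield_is_diff (X : vfield M) y : smooth_vfield X -> U y -> X y = 0 ->
  let c := @chart_at R M y in let d := @chart_at R N (f y) in
  is_diff (d (f y)) (vfield_in_chart (push_vfield f f' X) d)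
    (fun v => v *m (mderiv d c f' (f y) *m linearization X y *m mderiv c d f y)).
Proof.
case: ff' => -[oU oV sf sf'] [fV f'U f'f f'K] sX Uy Xy0 c d.
have ac : atlas M c := chart_at_atlas y.
have ad : atlas N d := chart_at_atlas (f y).
have cy : chart_dom c y := chart_at_dom y.
have dy : chart_dom d (f y) := chart_at_dom (f y).
have df' := smooth_in_mdifferentiable (fV _ Uy) sf'.
pose h := d \o f \o cinv c; pose h' := c \o f' \o cinv d.
pose Xc := vfield_in_chart X c; set b := d (f y).
have h'b : h' b = c y by rewrite /h' /b /= cmapK// f'f.
have dXc : differentiable Xc (c y).
  by have [k _] := sX c ac 1%N; apply: k; exists y.
have Xc0 : Xc (c y) = 0.
  by rewrite /Xc /vfield_in_chart cmapK// Xy0; exact: mul0mx.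
have dh' : differentiable h' b.
  by have [_ k] := df'; apply: k; rewrite ?f'f.
have dXh : differentiable (Xc \o h') b by apply: differentiable_comp; rewrite ?h'b.
have Xh0 : (Xc \o h') b = 0 by rewrite /= h'b.
have cJ : {for c y, continuous (jacobian h)}.
  have [_ k] := sf; apply: (continuous_jacobian (k c d ac ad 1%N)).
  by exists y.
have cJh : {for b, continuous (jacobian h \o h')}.
  apply: continuous_comp; first exact: differentiable_continuous.
  by rewrite h'b.
have E : \forall p \near b, (Xc \o h') p *m (jacobian h \o h') p =
    vfield_in_chart (push_vfield f f' X) d p.
  near=> p.
  have Vz : V (cinv d p).
    near: p; apply: (chart_inv_near (P := V) dy).
    by apply: open_nbhs_nbhs; split=> //; exact: fV.
  have cz : chart_dom c (f' (cinv d p)).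
    near: p; apply: (chart_inv_near (P := f' @^-1` chart_dom c) dy).
    have [k _] := df'; have cn := chart_dom_near cy.
    by rewrite -{1}(f'f _ Uy) in cn; exact: (k _ cn).
  have [dz dK] : chart_dom d (cinv d p) /\ d (cinv d p) = p.
    by near: p; exact: chart_invK_near.
  set z := cinv d p in Vz cz dz *.
  have dfz := smooth_in_mdifferentiable (f'U _ Vz) sf.
  have dz' : chart_dom d (f (f' z)) by rewrite f'K.
  have := tcoord_differential (X (f' z)) dfz ac ad cz dz'.
  rewrite (f'K _ Vz) => k.
  apply: etrans (esym k).
  by rewrite /Xc /vfield_in_chart /h' /= -/z (cmapK cz).
apply: near_is_diff E _.
have [k1 k2] := is_diff_mulmx0 dXh Xh0 cJh.
apply: DiffDef => //; rewrite k2; apply/funext => v.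
have -> : (jacobian h \o h') b = mderiv c d f y by rewrite /= h'b.
rewrite !mulmxA; congr (_ *m _).
have dXc' : differentiable Xc (h' b) by rewrite h'b.
have := jacobian_comp dh' dXc'; rewrite h'b => k.
rewrite -jacobianE k mulmxA.
by [].
Unshelve. all: by end_near. Qed.

End Diffeomorphisms.
Theorem theorem1p10 (R : realType) (G : lie_group R) (expG : exponential G)
    (M : manifold R) (A : smooth_action G M) (properA : proper_action A)
    (X : vfield M) (smoothX : smooth_vfield X)
    (invX : invariant_vfield [set: G] A X)
    (x1 x2 : M) (same_orbit : exists g : G, A g x1 = x2)
    (req1 : relative_equilibrium expG A X x1)
    (req2 : relative_equilibrium expG A X x2)
    (S1 : slice A x1) (S2 : slice A x2)
    (m1 m2 : {vspace Lie G})
    (split1 : equivariant_splitting expG (stabilizer A x1) m1)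
    (split2 : equivariant_splitting expG (stabilizer A x2) m2)
    (XS1 : vfield S1) (XS2 : vfield S2)
    (smoothXS1 : smooth_vfield XS1) (smoothXS2 : smooth_vfield XS2)
    (invXS1 : invariant_vfield (stabilizer A x1) (slice_act S1) XS1)
    (invXS2 : invariant_vfield (stabilizer A x2) (slice_act S2) XS2)
    (compXS1 : slice_component expG m1 X XS1)
    (compXS2 : slice_component expG m2 X XS2)
    (U1 : set S1) (U2 : set S2)
    (shrunk1 : shrunk_slice U1) (shrunk2 : shrunk_slice U2)
    (phi : S1 -> S2) (phi_inv : S2 -> S1)
    (diffeo_phi : diffeo_on U1 U2 phi phi_inv)
    (equiv_phi : equivariant_slice_map U1 phi)
    (phi_pt : phi (slice_pt S1) = slice_pt S2)
    (iso_phi : isomorphic_vfields expG U2 (push_vfield phi phi_inv XS1) XS2) :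
  exists Tinv : 'M[R]_(mdim S2, mdim S1),
    let T := differential phi (slice_pt S1) in
    let D1 := linearization XS1 (slice_pt S1) in
    let D2 := linearization XS2 (slice_pt S2) in
    [/\ T *m Tinv = 1%:M,
        Tinv *m T = 1%:M,
        (exists2 xi : Lie G, sub_lie_fixed expG (stabilizer A x2) xi &
           D2 - Tinv *m D1 *m T = slice_drep expG S2 xi),
        maps_eigenvectors D1 T D2 &
        maps_eigenvectors D2 Tinv D1].

Proof.
set s1 := slice_pt S1 in phi_pt *; set s2 := slice_pt S2 in phi_pt *.
have X10 : XS1 s1 = 0 := slice_component_zero req1 compXS1.
have X20 : XS2 s2 = 0 := slice_component_zero req2 compXS2.
have [oU1 Us1 _] := shrunk1; have [oU2 Us2 _] := shrunk2.
have nU2 : nbhs s2 U2 by exact: (open_nbhs_nbhs (conj oU2 Us2)).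
pose c1 := @chart_at R S1 s1; pose c2 := @chart_at R S2 s2.
have ac1 : atlas S1 c1 := chart_at_atlas s1.
have ac2 : atlas S2 c2 := chart_at_atlas s2.
have c1s : chart_dom c1 s1 := chart_at_dom s1.
have c2s : chart_dom c2 s2 := chart_at_dom s2.
have phis : chart_dom c2 (phi s1) by rewrite phi_pt.
have TE : differential phi s1 = mderiv c1 c2 phi s1.
  by rewrite differentialE phi_pt.
pose Tinv := mderiv c2 c1 phi_inv s2; exists Tinv => T D1 D2.
have TTinv : T *m Tinv = 1%:M.
  have := diffeo_mderivK diffeo_phi Us1 ac1 ac2 c1s phis.
  by rewrite /T TE phi_pt.
have TinvT : Tinv *m T = 1%:M.
  have := diffeo_mderivKV diffeo_phi Us1 ac1 ac2 c1s phis.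
  by rewrite /T TE phi_pt.
have [psi [spsi Hpsi psiH Zpsi]] := iso_phi.
pose b := c2 s2; pose Z := push_vfield phi phi_inv XS1.
have dpsi : differentiable (psi \o cinv c2) b.
  have [k _] := spsi c2 ac2 1%N; apply: k.
  exact: (ex_intro2 _ _ s2 (conj Us2 c2s) erefl).
pose ZV := vfield_in_chart Z c2; pose XV := vfield_in_chart XS2 c2.
have dZ : is_diff b ZV (fun v => v *m (Tinv *m D1 *m T)).
  have := push_vfield_is_diff diffeo_phi smoothXS1 Us1 X10.
  by rewrite /= /b /ZV /Z /T TE phi_pt.
have dX : differentiable XV b.
  by have [k _] := smoothXS2 c2 ac2 1%N; apply: k; exists s2.
have dX' : is_diff b XV (fun v => v *m D2).
  split; first exact: dX.
  by apply/funext => v; rewrite [RHS]jacobianE.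
(* By the isomorphism of the two fields, this difference is the chart expression of [psi_S] near
   [s2]. *)
pose W p := ZV p - XV p.
have dW : is_diff b W (fun v => v *m (Tinv *m D1 *m T) - v *m D2).
  exact: (is_diffB dZ dX').
have WE : \forall p \near b, W p = @tcoord R S2 c2 (cinv c2 p)
    (fundamental expG (slice_act S2) (psi (cinv c2 p)) (cinv c2 p)).
  near=> p; have Up : U2 (cinv c2 p).
    near: p; apply: (chart_inv_near (P := U2) c2s).
    exact: nU2.
  rewrite /W /ZV /XV /vfield_in_chart /Z (Zpsi _ Up).
  by rewrite tcoordD addrAC subrr add0r.
have Hxi := Hpsi _ Us2; have [dW1 dW2] := dW.
have JW : jacobian W b = Tinv *m D1 *m T - D2.
  apply/row_matrixP => k; rewrite [LHS]rowE [RHS]rowE jacobianE dW2.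
  by rewrite mulmxBr.
have dK := slice_rep_fundamental_derive oU2 Us2 Hpsi dpsi dW1 WE.
set K := jacobian _ _ in dK.
have KE : D2 - Tinv *m D1 *m T = - K.
  by rewrite -[K]/(jacobian W b) JW opprB.
have sK := slice_generator_semisimple Hxi dK properA.
have D2K := slice_generator_comm Hxi dK smoothXS2 invXS2 X20.
have KJ : Tinv *m D1 *m T - D2 = K by exact: esym JW.
have [m12 m21] := maps_eigenvectors_conj TTinv TinvT KJ D2K sK.
split; [exact: TTinv|exact: TinvT| |exact: m12|exact: m21].
(* The sign comes from [psi_S] being the transported field minus [XS2], whereas the claim subtracts
   in the other order. Invariance under [Ad h] is the equivariance of [psi] at the point [s2], which
   [h] fixes. *)
exists (- psi s2); last by rewrite KE (slice_drepN dK).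
split=> [t|h Hh]; first by rewrite scalerN -scaleNr; exact: Hxi.
rewrite /Ad mulNmx -[X in - X]/(Ad h (psi s2)) -(psiH _ _ Hh Us2).
by rewrite (slice_act_pt S2 Hh).
Unshelve. all: by end_near. Qed.
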